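(* Let $\alpha,\beta\in\mathbb{N}_0$ and let $M,N>0$. Koornwinder's generalized Jacobi polynomials $y_n(x)=P_n^{\alpha,\beta,M,N}(x)$, $n\in\mathbb{N}_0$, are the eigenfunctions of the generalized Jacobi equation $$\Big\{\big[L_{2,x}^{\alpha,\beta}-\Lambda_{2,n}^{\alpha,\beta}\big]+\frac{M}{b_{\beta,\alpha}}\big[\widetilde L_{2\beta+4,x}^{\beta,\alpha}-\Lambda_{2\beta+4,n}^{\beta,\alpha}\big]+\frac{N}{b_{\alpha,\beta}}\big[L_{2\alpha+4,x}^{\alpha,\beta}-\Lambda_{2\alpha+4,n}^{\alpha,\beta}\big]+\frac{MN}{c_{\alpha,\beta}}\big[L_{2\alpha+2\beta+6,x}^{\alpha,\beta}-\Lambda_{2\alpha+2\beta+6,n}^{\alpha,\beta}\big]\Big\}y_n(x)=0,$$ where, for any sufficiently smooth functions $y(x)$, $$L_{2,x}^{\alpha,\beta}y(x)=\frac{1}{(x-1)^{\alpha}(x+1)^{\beta}}D_x\big[(x-1)^{\alpha+1}(x+1)^{\beta+1}D_xy(x)\big],$$ $$\widetilde L_{2\beta+4,x}^{\beta,\alpha}y(x)=\frac{x+1}{(x-1)^{\alpha}}D_x^{\beta+2}\Big\{(x-1)^{\alpha+\beta+2}D_x^{\beta+2}\big[(x+1)^{\beta+1}y(x)\big]\Big\},$$ $$L_{2\alpha+4,x}^{\alpha,\beta}y(x)=\frac{x-1}{(x+1)^{\beta}}D_x^{\alpha+2}\Big\{(x+1)^{\alpha+\beta+2}D_x^{\alpha+2}\big[(x-1)^{\alpha+1}y(x)\big]\Big\},$$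 $$L_{2\alpha+2\beta+6,x}^{\alpha,\beta}y(x)=(x^2-1)D_x^{\alpha+\beta+3}\Big\{(x-1)^{\beta+1}(x+1)^{\alpha+1}D_x^{\alpha+\beta+3}\big[(x-1)^{\alpha+1}(x+1)^{\beta+1}y(x)\big]\Big\}.$$ Expanding these four differential expressions as power series in $D_x^i$, $$L_{2,x}^{\alpha,\beta}y(x)=\sum_{i=1}^{2}c_i^{\alpha,\beta}(x)D_x^iy(x),\qquad \widetilde L_{2\beta+4,x}^{\beta,\alpha}y(x)=\sum_{i=1}^{2\beta+4}\widetilde d_i^{\,\beta,\alpha}(x)D_x^iy(x),$$ $$L_{2\alpha+4,x}^{\alpha,\beta}y(x)=\sum_{i=1}^{2\alpha+4}d_i^{\alpha,\beta}(x)D_x^iy(x),\qquad L_{2\alpha+2\beta+6,x}^{\alpha,\beta}y(x)=\sum_{i=1}^{2\alpha+2\beta+6}e_i^{\alpha,\beta}(x)D_x^iy(x),$$ the coefficient functions are polynomials of degree $i$ in $x$, where those of highest degree are of a particularly simple form, i.e. $c_1^{\alpha,\beta}(x)=\alpha-\beta+(\alpha+\beta+2)x$, $c_2^{\alpha,\beta}(x)=x^2-1$, $\widetilde d_{2\beta+4}^{\,\beta,\alpha}(x)=(x^2-1)^{\beta+2}$, $d_{2\alpha+4}^{\alpha,\beta}(x)=(x^2-1)^{\alpha+2}$, and $e_{2\alpha+2\beta+6}^{\alpha,\beta}(x)=(x^2-1)^{\alpha+\beta+3}$.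
   Context: $\mathbb{N}_0=\{0,1,2,\dots\}$; $(a)_k=a(a+1)\cdots(a+k-1)$, $(a)_0=1$, is the Pochhammer symbol; $D_x^i$ denotes $i$-fold differentiation with respect to $x$, acting on everything inside the bracket that follows. Jacobi polynomials: $P_n^{\alpha,\beta}(x)=\frac{(\alpha+1)_n}{n!}\,{}_2F_1\big(-n,n+\alpha+\beta+1;\alpha+1;\frac{1-x}{2}\big)$, $n\in\mathbb{N}_0$. Koornwinder's generalized Jacobi polynomials: $P_n^{\alpha,\beta,M,N}(x)=P_n^{\alpha,\beta}(x)+MQ_n^{\alpha,\beta}(x)+NR_n^{\alpha,\beta}(x)+MNS_n^{\alpha,\beta}(x)$, $n\in\mathbb{N}_0$, where $Q_0^{\alpha,\beta}=R_0^{\alpha,\beta}=S_0^{\alpha,\beta}=S_1^{\alpha,\beta}=0$ and $Q_n^{\alpha,\beta}(x)=q_n^{\alpha,\beta}(x+1)P_{n-1}^{\alpha,\beta+2}(x)$ with $q_n^{\alpha,\beta}=\frac{(\alpha+\beta+2)_n(\beta+2)_{n-1}}{2\,n!\,(\alpha+1)_{n-1}}$ for $n\ge1$; $R_n^{\alpha,\beta}(x)=r_n^{\alpha,\beta}(x-1)P_{n-1}^{\alpha+2,\beta}(x)$ with $r_n^{\alpha,\beta}=\frac{(\alpha+\beta+2)_n(\alpha+2)_{n-1}}{2\,n!\,(\beta+1)_{n-1}}$ for $n\ge1$; $S_n^{\alpha,\beta}(x)=s_n^{\alpha,\beta}(x^2-1)P_{n-2}^{\alpha+2,\beta+2}(x)$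 with $s_n^{\alpha,\beta}=\frac{(\alpha+\beta+2)_n(\alpha+\beta+2)_{n+1}}{4(\alpha+1)(\beta+1)(n-1)!\,n!}$ for $n\ge2$. Constants: $b_{\alpha,\beta}=(\alpha+2)!\,(\beta+1)_{\alpha+1}$ (so $b_{\beta,\alpha}=(\beta+2)!\,(\alpha+1)_{\beta+1}$) and $c_{\alpha,\beta}=(\alpha+1)(\beta+1)(\alpha+\beta+3)\big((\alpha+\beta+1)!\big)^2$. Eigenvalue components: $\Lambda_{2,n}^{\alpha,\beta}=n(n+\alpha+\beta+1)$, $\Lambda_{2\alpha+4,n}^{\alpha,\beta}=(n)_{\alpha+2}(n+\beta)_{\alpha+2}$, $\Lambda_{2\beta+4,n}^{\beta,\alpha}=(n)_{\beta+2}(n+\alpha)_{\beta+2}$, $\Lambda_{2\alpha+2\beta+6,n}^{\alpha,\beta}=(n-1)_{\alpha+\beta+3}(n)_{\alpha+\beta+3}$.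
   Formalization: The coefficient e_1 is identically zero (the operator of order 2α+2β+6 annihilates y = x), so it does not have degree 1; for e_1 only degree at most 1 is stated, while all other coefficients are shown to have exact degree i. *)

(* Defs.v *)
From HB Require Import structures.
From mathcomp Require Import all_boot all_order all_algebra.
From mathcomp Require Import all_classical all_reals all_analysis.
Set Implicit Arguments.
Unset Strict Implicit.
Unset Printing Implicit Defensive.
Import Order.TTheory GRing.Theory Num.Theory.
Import numFieldNormedType.Exports.
Local Open Scope classical_set_scope.
Local Open Scope ring_scope.

Section Polynomials.
Variable R : realType.
Implicit Types (a b c x z M N : R) (n k : nat).

Definition poch a k : R := \prod_(i < k) (a + i%:R).

(* The sum of the series; it terminates in all uses below, since there the
   first parameter is a non-positive integer. *)
Definition hyp2F1 a b c z : R :=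
  limn (series (fun k =>
    poch a k * poch b k / (poch c k * k`!%:R) * z ^+ k)).

Definition jacobi n a b x : R :=
  poch (a + 1) n / n`!%:R *
  hyp2F1 (- n%:R) (n%:R + a + b + 1) (a + 1) ((1 - x) / 2).

Definition koorn_q n a b : R :=
  poch (a + b + 2) n * poch (b + 2) n.-1 / (2 * n`!%:R * poch (a + 1) n.-1).

Definition koorn_r n a b : R :=
  poch (a + b + 2) n * poch (a + 2) n.-1 / (2 * n`!%:R * poch (b + 1) n.-1).

Definition koorn_s n a b : R :=
  poch (a + b + 2) n * poch (a + b + 2) n.+1 /
  (4 * (a + 1) * (b + 1) * n.-1`!%:R * n`!%:R).

Definition koorn_Q n a b x : R :=
  if n is m.+1 then koorn_q n a b * (x + 1) * jacobi m a (b + 2) x else 0.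

Definition koorn_R n a b x : R :=
  if n is m.+1 then koorn_r n a b * (x - 1) * jacobi m (a + 2) b x else 0.

Definition koorn_S n a b x : R :=
  if n is m.+2 then koorn_s n a b * (x ^+ 2 - 1) * jacobi m (a + 2) (b + 2) x
  else 0.

Definition koornwinder n a b M N x : R :=
  jacobi n a b x + M * koorn_Q n a b x + N * koorn_R n a b x
  + M * N * koorn_S n a b x.

End Polynomials.

Section Constants.
Variable R : realType.
Implicit Types alpha beta n : nat.

Definition bconst alpha beta : R :=
  (alpha + 2)`!%:R * poch (beta%:R + 1) alpha.+1.

Definition cconst alpha beta : R :=
  (alpha%:R + 1) * (beta%:R + 1) * (alpha%:R + beta%:R + 3)
  * (alpha + beta + 1)`!%:R ^+ 2.

Definition Lambda2 alpha beta n : R :=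
  n%:R * (n%:R + alpha%:R + beta%:R + 1).

Definition Lambda4 alpha beta n : R :=
  poch n%:R (alpha + 2) * poch (n%:R + beta%:R) (alpha + 2).

Definition Lambda6 alpha beta n : R :=
  poch (n%:R - 1) (alpha + beta + 3) * poch n%:R (alpha + beta + 3).

End Constants.

(* [derive1n k f] is the k-th derivative of f.  Because of the quotients, L2,
   Ltilde and L4 are meaningful only for x distinct from 1 and -1. *)
Section Operators.
Variable R : realType.
Implicit Types (alpha beta : nat) (y : R -> R) (x : R).

Definition L2 alpha beta y x : R :=
  ((x - 1) ^+ alpha * (x + 1) ^+ beta)^-1 *
  derive1n 1 (fun t : R =>
    (t - 1) ^+ alpha.+1 * (t + 1) ^+ beta.+1 * derive1n 1 y t) x.

(* The parameters are swapped, as in the superscripts of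
   $\widetilde L_{2\beta+4,x}^{\beta,\alpha}$. *)
Definition Ltilde beta alpha y x : R :=
  (x + 1) / (x - 1) ^+ alpha *
  derive1n (beta + 2) (fun t : R =>
    (t - 1) ^+ (alpha + beta + 2) *
    derive1n (beta + 2) (fun s : R => (s + 1) ^+ beta.+1 * y s) t) x.

Definition L4 alpha beta y x : R :=
  (x - 1) / (x + 1) ^+ beta *
  derive1n (alpha + 2) (fun t : R =>
    (t + 1) ^+ (alpha + beta + 2) *
    derive1n (alpha + 2) (fun s : R => (s - 1) ^+ alpha.+1 * y s) t) x.

Definition L6 alpha beta y x : R :=
  (x ^+ 2 - 1) *
  derive1n (alpha + beta + 3) (fun t : R =>
    (t - 1) ^+ beta.+1 * (t + 1) ^+ alpha.+1 *
    derive1n (alpha + beta + 3)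
      (fun s : R => (s - 1) ^+ alpha.+1 * (s + 1) ^+ beta.+1 * y s) t) x.

(* Left-hand side of the generalized Jacobi equation.  The four operators are
   parameters so that the equation can be written both with the operators above
   and with their expansions in powers of the derivative. *)
Definition gen_jacobi_lhs alpha beta (M N : R) (n : nat)
    (A2 At A4 A6 : (R -> R) -> R -> R) y x : R :=
    (A2 y x - Lambda2 R alpha beta n * y x)
  + M / bconst R beta alpha * (At y x - Lambda4 R beta alpha n * y x)
  + N / bconst R alpha beta * (A4 y x - Lambda4 R alpha beta n * y x)
  + M * N / cconst R alpha beta * (A6 y x - Lambda6 R alpha beta n * y x).

Definition times_derivable (m : nat) y x : Prop :=
  \forall z \near x, forall i : nat, (i < m)%N -> derivable (derive1n i y) z 1.

Definition diffop (m : nat) (p : nat -> {poly R}) y x : R :=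
  \sum_(1 <= i < m.+1) (p i).[x] * derive1n i y x.

Definition expands_as (L : (R -> R) -> R -> R) (m : nat) (p : nat -> {poly R})
    : Prop :=
  forall y x, x != 1 -> x != -1 -> times_derivable m y x ->
  L y x = diffop m p y x.

End Operators.

(* Main.v *)
(* On a polynomial p each of the four operators satisfies
     w L p = U D^K (V D^K (U p)),   w = (x - 1)^alpha (x + 1)^beta,
   for suitable products U, V of powers of x - 1 and x + 1. Integrating by parts
   K times turns the integral of w (L p) g into a symmetric form plus boundary
   terms at -1 and 1. The constants are such that in the bilinear form
     <f, g> = h \int_{-1}^1 (1 - x)^alpha (1 + x)^beta f g dx
              + M f(-1) g(-1) + N f(1) g(1)
   these boundary terms cancel against the point evaluations of the other
   operators, so the combined operator is symmetric for <., .>. It maps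
   polynomials of degree at most n to such polynomials, acting on the
     coefficient
   of x^n by the eigenvalue. Koornwinder's y_n is orthogonal to all polynomials
   of smaller degree, hence F = L y_n - Lambda_n y_n has degree less than n and
   <F, F> = 0, so F = 0.

   The coefficients of D^K V D^K U are computed by applying the rule
   D o p_i D^i = p_i' D^i + p_i D^(i+1) step by step; their degrees and the
   positivity of their leading coefficients are followed along these steps. *)

Require Import Defs.
From HB Require Import structures.
From mathcomp Require Import all_boot all_order all_algebra.
From mathcomp Require Import all_classical all_reals all_analysis.
From mathcomp Require Import ring lra zify.
From mathcomp Require polyrcf.
Set Implicit Arguments.
Unset Strict Implicit.
Unset Printing Implicit Defensive.
Import Order.TTheory GRing.Theory Num.Theory.
Import numFieldNormedType.Exports.
Local Open Scope classical_set_scope.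
Local Open Scope ring_scope.

(** * Formal differential operators *)

Section FormalOperators.
Variable R : comNzRingType.
Implicit Types (p : nat -> {poly R}) (q U V d : {poly R}).

(* The sequence p stands for the operator \sum_i p_i D^i; dstep p is its
   composition D o p. *)
Definition dstep p i := (p i)^`() + (if i is j.+1 then p j else 0).

Definition dzero U i : {poly R} := if i is 0 then U else 0.

(** The coefficients of [D^K V D^K U], the common shape of the four operators up to a rational
    prefactor. *)
Definition jop K U V := iter K dstep (fun i => V * iter K dstep (dzero U) i).

Definition dapp m p q := \sum_(i < m) p i * q^`(i).

Lemma dapp_dstep m p q : (forall i, (m <= i)%N -> p i = 0) ->
  (dapp m p q)^`() = dapp m.+1 (dstep p) q.
Proof.
move=> p0; rewrite /dapp raddf_sum /=.
under eq_bigr do rewrite derivM -derivnS.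
under [RHS]eq_bigr do rewrite /dstep mulrDl.
rewrite !big_split /=; congr (_ + _).
  by rewrite [RHS]big_ord_recr /= p0// deriv0 mul0r addr0.
by rewrite [RHS]big_ord_recl /= mul0r add0r.
Qed.

Lemma dstep_eq0 m p : (forall i, (m <= i)%N -> p i = 0) ->
  forall i, (m.+1 <= i)%N -> dstep p i = 0.
Proof.
by move=> p0 [//|i] mi; rewrite /dstep !p0 ?deriv0 ?addr0// ltnW.
Qed.

Lemma iter_dstep_eq0 m k p : (forall i, (m <= i)%N -> p i = 0) ->
  forall i, (m + k <= i)%N -> iter k dstep p i = 0.
Proof.
elim: k => [|k IH] p0 i; first by rewrite addn0; apply: p0.
rewrite addnS /=; exact: dstep_eq0 (IH p0) _.
Qed.

Lemma dapp_iter_dstep m k p q : (forall i, (m <= i)%N -> p i = 0) ->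
  (dapp m p q)^`(k) = dapp (m + k) (iter k dstep p) q.
Proof.
move=> p0; elim: k => [|k IH]; first by rewrite derivn0 addn0.
by rewrite derivnS IH addnS /= dapp_dstep//; exact: iter_dstep_eq0.
Qed.

Lemma dapp_mul m p q V : V * dapp m p q = dapp m (fun i => V * p i) q.
Proof. by rewrite /dapp mulr_sumr; under eq_bigr do rewrite mulrA. Qed.

Lemma dzero_eq0 U i : (1 <= i)%N -> dzero U i = 0.
Proof. by case: i. Qed.

Lemma inner_eq0 K U V i : (1 + K <= i)%N -> V * iter K dstep (dzero U) i = 0.
Proof.
by move=> h; rewrite (iter_dstep_eq0 (@dzero_eq0 U))// mulr0.
Qed.

Lemma dapp_dzero U q : dapp 1 (dzero U) q = U * q.
Proof. by rewrite /dapp big_ord1 derivn0. Qed.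

Lemma jopE K U V q :
  (V * (U * q)^`(K))^`(K) = dapp (2 * K).+1 (jop K U V) q.
Proof.
rewrite -(dapp_dzero U q) (dapp_iter_dstep _ _ (@dzero_eq0 U)) dapp_mul.
rewrite (dapp_iter_dstep _ _ (@inner_eq0 K U V)); congr dapp.
by rewrite add1n addSn addnn mul2n.
Qed.

Lemma iter_dstep0 k p : p 0%N = 0 -> iter k dstep p 0%N = 0.
Proof. by move=> p0; elim: k => //= k IH; rewrite /dstep IH deriv0 addr0. Qed.

(** At the new top index the coefficient to be differentiated is already 0, so only the shift in
    [dstep] contributes. *)
Lemma iter_dstep_top m k p : (forall i, (m < i)%N -> p i = 0) ->
  iter k dstep p (m + k)%N = p m.
Proof.
move=> p0; elim: k => [|k IH]; first by rewrite addn0.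
rewrite addnS /= /dstep IH.
rewrite (iter_dstep_eq0 (m := m.+1)) ?deriv0 ?add0r// => i; exact: p0.
Qed.

Lemma jop_top K U V : jop K U V (2 * K)%N = V * U.
Proof.
rewrite /jop mul2n -addnn iter_dstep_top => [|i Ki].
  by rewrite -[X in iter _ _ _ X]add0n iter_dstep_top//; case.
exact: inner_eq0.
Qed.

End FormalOperators.

Arguments dstep {R}.
Arguments dzero {R}.
Arguments jop {R}.
Arguments dapp {R}.

(** * Divisibility of the coefficients by powers of X - c *)

Lemma dvdp_exp_deriv (F : fieldType) (c : F) m (q : {poly F}) :
  ('X - c%:P) ^+ m.+1 %| q -> ('X - c%:P) ^+ m %| q^`().
Proof.
move=> /dvdpP[r ->]; rewrite derivM deriv_exp derivXsubC mul1r /=.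
rewrite dvdp_add//; last by rewrite mulrnAr -mulrnAl dvdp_mulIr.
by rewrite exprS mulrA dvdp_mulIr.
Qed.

Lemma dvdp_exp_derivn (F : fieldType) (c : F) m k (q : {poly F}) :
  ('X - c%:P) ^+ (m + k) %| q -> ('X - c%:P) ^+ m %| q^`(k).
Proof.
elim: k q => [|k IH] q; first by rewrite addn0 derivn0.
by rewrite addnS => /dvdp_exp_deriv /IH; rewrite -derivSn.
Qed.

Lemma dvdp_exp_dstep (F : fieldType) (c : F) m (p : nat -> {poly F}) :
  (forall i, ('X - c%:P) ^+ m.+1 %| p i) ->
  forall i, ('X - c%:P) ^+ m %| dstep p i.
Proof.
move=> hp i; rewrite /dstep dvdp_add//; first exact: dvdp_exp_deriv.
by case: i => [|i]; [exact: dvdp0 | exact: dvdp_trans (dvdp_exp2l _ _) (hp i)].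
Qed.

(** Each [dstep] costs at most one factor [X - c]; this makes the division of the operators by their
    weight exact. *)
Lemma dvdp_exp_iter_dstep (F : fieldType) (c : F) m k (p : nat -> {poly F}) :
  (forall i, ('X - c%:P) ^+ (m + k) %| p i) ->
  forall i, ('X - c%:P) ^+ m %| iter k dstep p i.
Proof.
elim: k p => [|k IH] p hp; first by rewrite addn0 in hp.
rewrite iterSr; apply: IH; apply: dvdp_exp_dstep => i; rewrite -addnS; exact:
  hp.
Qed.

(** * Degrees and leading coefficients along the composition steps *)

Section Grading.
Variable R : numDomainType.
Implicit Types (p : nat -> {poly R}) (q U V : {poly R}).

(* D - s - 1 bounds deg p_i - i; the truncated difference i + D - s also covers
   the case where this bound is negative, and then p_i = 0. *)
Definition graded (D s lo hi : nat) p :=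
  [/\ forall i, (size (p i) <= i + D - s)%N,
      forall i, 0 <= (p i)`_(i + D - s).-1,
      forall i, (lo <= i <= hi)%N -> (s < i + D)%N ->
        0 < (p i)`_(i + D - s).-1
    & forall i, (hi < i)%N -> p i = 0].

(** Both summands of [dstep] have a nonnegative coefficient in the extremal degree, so they cannot
    cancel. The derivative gives positivity up to [hi], the shift gives it at [hi.+1]. *)
Lemma graded_dstep D s lo hi p : (lo <= hi)%N -> graded D s lo hi p ->
  graded D s.+1 lo hi.+1 (dstep p).
Proof.
move=> lohi [psz pge0 pgt0 p0].
have dge0 i : 0 <= (p i)^`()`_(i + D - s.+1).-1.
  rewrite coef_deriv mulrn_wge0//.
  (* When the bound is truncated the index falls back to 0, and the coefficient of X of a constant
     is read off. *)
  have [h|h] := leqP (s + 2) (i + D); last first.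
    by rewrite nth_default//; apply: leq_trans (psz i) _; lia.
  by have -> : (i + D - s.+1).-1.+1 = (i + D - s).-1 by lia.
split.
- move=> i; rewrite /dstep (leq_trans (size_polyD _ _))// geq_max.
  apply/andP; split.
    have [->|/lt_size_deriv h] := eqVneq (p i) 0; first by rewrite deriv0
      size_poly0.
    by rewrite -ltnS (leq_trans h)// (leq_trans (psz i))//; lia.
  by case: i => [|i]; rewrite ?size_poly0//; apply: leq_trans (psz i) _; lia.
- move=> i; rewrite /dstep coefD addr_ge0//.
  by case: i => [|i]; rewrite ?coef0//; have := pge0 i; rewrite addSn subSS.
- move=> i ihi sD; rewrite /dstep coefD.
  have [ih|ih] := leqP i hi.
    rewrite ltr_pwDl//.
      rewrite coef_deriv; have -> : (i + D - s.+1).-1.+1 = (i + D - s).-1 by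
        lia.
      rewrite pmulrn_rgt0 ?pgt0//; lia.
    by case: i {ihi sD ih} => [|i]; rewrite ?coef0//.
  have -> : i = hi.+1 by lia.
  by rewrite ltr_wpDl// addSn subSS pgt0//; lia.
- by move=> i hi'; apply: dstep_eq0 hi' => j; exact: p0.
Qed.

Lemma graded_iter_dstep D s k lo hi p : (lo <= hi)%N -> graded D s lo hi p ->
  graded D (s + k) lo (hi + k) (iter k dstep p).
Proof.
move=> lohi gp; elim: k => [|k IH]; first by rewrite !addn0.
by rewrite !addnS; apply: graded_dstep IH; lia.
Qed.

Lemma graded_raise D s lo lo' hi p : (lo <= lo')%N -> graded D s lo hi p ->
  graded D s lo' hi p.
Proof. by move=> h [h1 h2 h3 h4]; split => // i /andP[? ?]; apply: h3; lia. Qed.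

Lemma coefM_monic_top V q e m : V \is monic -> size V = e.+1 ->
  (size q <= m.+1)%N -> (V * q)`_(e + m) = q`_m.
Proof.
move=> Vm Vs qs; rewrite coefM (bigD1 (inord e)) //= inordK ?ltnS ?leq_addr//.
have -> : V`_e = 1 by move/monicP: Vm; rewrite lead_coefE Vs.
rewrite mul1r addKn big1 ?addr0// => i ie.
have [h|h] := ltnP e i; first by rewrite nth_default ?mul0r// Vs.
rewrite [q`__]nth_default ?mulr0// (leq_trans qs)//.
suff : (i < e)%N by move: (ltn_ord i); lia.
rewrite ltn_neqAle h andbT; apply: contra ie => /eqP ie.
by apply/eqP/val_inj; rewrite /= inordK // ltnS leq_addr.
Qed.

(** A monic factor of degree [e] shifts the extremal degree by [e] and keeps the coefficient there.
    The two hypotheses on [lo] exclude truncated bounds, which would not shift by [e]. *)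
Lemma graded_mul D s lo hi p V e : V \is monic -> size V = e.+1 ->
  (forall i, (i < lo)%N -> p i = 0) ->
  (forall i, (lo <= i)%N -> (s < i + D)%N) ->
  graded D s lo hi p -> graded (D + e) s lo hi (fun i => V * p i).
Proof.
move=> Vm Vs plo loD [psz pge0 pgt0 p0].
have top i : (lo <= i)%N ->
    (V * p i)`_(i + (D + e) - s).-1 = (p i)`_(i + D - s).-1.
  move=> /loD h; have -> : (i + (D + e) - s).-1 = (e + (i + D - s).-1)%N by lia.
  by apply: coefM_monic_top => //; have := psz i; lia.
have zer i : (i < lo)%N -> V * p i = 0 by move=> /plo ->; rewrite mulr0.
split.
- move=> i; have [/zer->|h] := ltnP i lo; first by rewrite size_poly0.
  rewrite (leq_trans (size_polyMleq _ _))// Vs.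
  by have := psz i; have := loD _ h; lia.
- by move=> i; have [/zer->|h] := ltnP i lo; rewrite ?coef0// top.
- by move=> i /andP[l h] _; rewrite top// pgt0 ?l ?h ?loD.
- by move=> i h; rewrite p0 ?mulr0.
Qed.

Lemma graded_dzero U K : U \is monic -> size U = K.+1 ->
  graded K.+1 0 0 0 (dzero U).
Proof.
move=> Um Us; have U1 : U`_K = 1 by move/monicP: Um; rewrite lead_coefE Us.
split => [[|i]|[|i]|[|i]|[|i]]//=; rewrite ?Us ?size_poly0 ?subn0 ?coef0//= U1.
  exact: ler01.
by rewrite ltr01.
Qed.

(** The degree of [U] is one less than the number of derivatives, so the order-zero coefficient
    vanishes after the inner ones. It is therefore dropped from the range before multiplying by
    [V]. *)
Lemma graded_jop K U V e : U \is monic -> size U = K.+1 ->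
  V \is monic -> size V = e.+1 ->
  graded (K.+1 + e) (2 * K.+1) 1 (2 * K.+1) (jop K.+1 U V).
Proof.
move=> Um Us Vm Vs; have g0 := graded_dzero Um Us.
have := graded_iter_dstep K.+1 (leqnn 0) g0; rewrite !add0n => g1.
have {}g1 := graded_raise (leq0n 1) g1.
have {}g1 : graded (K.+1 + e) K.+1 1 K.+1
    (fun i => V * iter K.+1 dstep (dzero U) i).
  apply: graded_mul g1 => //; last by move=> i; lia.
  case=> // _; have [s1 _ _ _] := graded_iter_dstep K.+1 (leqnn 0) g0.
  by apply/eqP; rewrite -size_poly_leq0; have := s1 0%N; lia.
have := graded_iter_dstep K.+1 _ g1.
by rewrite mul2n -addnn; apply.
Qed.

End Grading.

Lemma size_polyD_le (R : nzSemiRingType) (p q : {poly R}) n :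
  (size p <= n)%N -> (size q <= n)%N -> (size (p + q)%R <= n)%N.
Proof. by move=> pn qn; rewrite (leq_trans (size_polyD _ _))// geq_max pn. Qed.

Lemma size_mul_le (R : nzSemiRingType) (U q : {poly R}) k n :
  size U = k.+1 -> (size q <= n.+1)%N -> (size (U * q)%R <= (n + k).+1)%N.
Proof.
move=> Us qs; rewrite (leq_trans (size_polyMleq _ _))// Us addSn /=.
by rewrite addnC -addSn leq_add2r.
Qed.

Lemma coef_derivn_top (R : nzSemiRingType) (q : {poly R}) m j : (size q <=
  m.+1)%N ->
  (size q^`(j) <= (m - j).+1)%N /\ q^`(j)`_(m - j) = q`_m *+ m ^_ j.
Proof.
move=> qs; split.
  apply/leq_sizeP => i hi; rewrite coef_derivn nth_default ?mul0rn//.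
  by apply: leq_trans qs _; lia.
have [h|h] := leqP j m; first by rewrite coef_derivn subnKC.
rewrite ffact_small// mulr0n derivn_poly0 ?coef0//.
exact: leq_trans qs _.
Qed.

(** * Operators of the form (pref / den) D^K V D^K U *)

Section ReducedOperators.
Variable R : realFieldType.
Implicit Types (c : nat -> {poly R}) (p q U V : {poly R}).

(** A Euclidean quotient, exact under the hypothesis [dvd_den] below. *)
Definition rcoef (pref den : {poly R}) K U V i := (pref * jop K U V i) %/ den.

Definition diffopp m c q := \sum_(1 <= i < m.+1) c i * q^`(i).

Variables (pref den U V : {poly R}) (a b e k : nat).
Hypotheses (prefm : pref \is monic) (denm : den \is monic)
  (Um : U \is monic) (Vm : V \is monic).
Hypotheses (prefs : size pref = a.+1) (dens : size den = b.+1)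
  (Us : size U = k.+1) (Vs : size V = e.+1).
(** Balance of degrees: [pref V U / den] has degree [2 K], so the operator does not raise
    degrees. *)
Hypothesis abe : (a + e = b + k.+2)%N.
Hypothesis dvd_den : forall i, den %| pref * jop k.+1 U V i.

Let K := k.+1.
Let c := rcoef pref den K U V.

Lemma rcoefK i : den * c i = pref * jop K U V i.
Proof. by rewrite /c /rcoef mulrC divpK. Qed.

(** The inner derivatives annihilate [U], of degree [K - 1]; hence the expansion starts with the
    first derivative. *)
Lemma jop_0 : jop K U V 0%N = 0.
Proof.
have [s1 _ _ _] := graded_iter_dstep K (leqnn 0) (graded_dzero Um Us).
have /eqP z : iter K dstep (dzero U) 0 == 0.
  by rewrite -size_poly_leq0; have := s1 0%N; rewrite subnn.
by rewrite /jop iter_dstep0// z mulr0.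
Qed.

Let den0 : den != 0. Proof. exact: monic_neq0. Qed.

Lemma rcoef_eq0 i : jop K U V i = 0 -> c i = 0.
Proof. by rewrite /c /rcoef => ->; rewrite mulr0 div0p. Qed.

(** The positive extremal coefficient from [graded_jop] fixes the degree of [jop], and [abe] turns
    it into [i]. For [i + e <= K] the coefficient vanishes instead; among the four operators this
    concerns only the first coefficient of [L6]. *)
Lemma size_rcoef i : (1 <= i <= 2 * K)%N -> (K < i + e)%N -> size (c i) = i.+1.
Proof.
move=> iK Ke; have [jsz _ jgt0 _] := graded_jop Um Us Vm Vs.
have /(jgt0 _ iK) {}jgt0 : (2 * K < i + (K + e))%N by lia.
have j0 : jop K U V i != 0.
  by apply: contraTneq jgt0 => ->; rewrite coef0 ltxx.
have js : size (jop K U V i) = (i + (K + e) - 2 * K)%N.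
  apply/eqP; rewrite eqn_leq jsz /= leqNgt; apply/negP => h.
  move: jgt0; rewrite nth_default ?ltxx//; move: h; rewrite -/K.
  by case: (_ - _)%N.
rewrite size_divp// dens size_monicM// prefs js.
rewrite /K; lia.
Qed.

Lemma size_rcoef_le i : (size (c i) <= i.+1)%N.
Proof.
have [jsz _ _ j0] := graded_jop Um Us Vm Vs.
have [->|i0] := posnP i; first by rewrite rcoef_eq0 ?size_poly0// jop_0.
have [h|h] := ltnP (2 * K) i; first by rewrite rcoef_eq0 ?size_poly0// j0.
have [h'|h'] := ltnP K (i + e)%N; first by rewrite size_rcoef// i0 h.
rewrite rcoef_eq0 ?size_poly0//; apply/eqP; rewrite -size_poly_leq0.
by rewrite (leq_trans (jsz i))//; lia.
Qed.

Lemma rcoef_top : den * c (2 * K)%N = pref * (V * U).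
Proof. by rewrite rcoefK jop_top. Qed.

Lemma diffopp_rcoef q : den * diffopp (2 * K) c q = pref * (V * (U *
  q)^`(K))^`(K).
Proof.
rewrite jopE /dapp -(big_mkord predT (fun i => jop K U V i * q^`(i))).
rewrite big_ltn// jop_0 mul0r add0r !mulr_sumr.
by apply: eq_bigr => i _; rewrite !mulrA rcoefK.
Qed.

Lemma size_diffopp n q : (size q <= n.+1)%N ->
  (size (diffopp (2 * K) c q) <= n.+1)%N.
Proof.
move=> qs; apply: (leq_trans (size_sum _ _ _)).
apply/bigmax_leqP_seq => i _ _.
have [h|h] := leqP (size q) i.
  by rewrite derivn_poly0// mulr0 size_poly0.
rewrite (leq_trans (size_polyMleq _ _))//.
have aux x y : (x <= i.+1)%N -> (y <= n.+1 - i)%N -> (i < n.+1)%N ->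
  ((x + y).-1 <= n.+1)%N by lia.
apply: aux (size_rcoef_le i) _ (leq_trans h qs).
apply/leq_sizeP => j hj; rewrite coef_derivn nth_default ?mul0rn//.
by apply: leq_trans qs _; lia.
Qed.

(** Multiplication by a monic polynomial keeps the leading coefficient, so only the two blocks of
    derivatives contribute factors. The index [n.-1] is the degree left after the inner block,
    [n + k - K]. *)
Lemma coef_diffopp n q : (size q <= n.+1)%N ->
  (diffopp (2 * K) c q)`_n =
  q`_n * ((n + k) ^_ K)%:R * ((n.-1 + e) ^_ K)%:R.
Proof.
case: n => [|n] qs.
  rewrite ffact_small// mulr0 mul0r (size1_polyC qs) /diffopp big_nat big1
    ?coef0//.
  by case=> // i _; rewrite derivnC /= mulr0.
have UqS : (size (U * q)%R <= (n.+1 + k).+1)%N.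
  exact: size_mul_le.
have [s1 c1] := coef_derivn_top K UqS.
have E1 : (n.+1 + k - K = n)%N by rewrite /K; lia.
rewrite E1 in s1 c1.
have s2 : (size (V * (U * q)^`(K))%R <= (n + e).+1)%N.
  exact: size_mul_le.
have [s3 c3] := coef_derivn_top K s2.
(* If [n + e < K] the outer derivatives annihilate everything and the second falling factorial is 0;
   otherwise the subtractions below are exact. *)
have [h|h] := ltnP (n + e) K.
  have z : (V * (U * q)^`(K))^`(K) = 0 by apply: derivn_poly0; apply: leq_trans
    s2 _.
  have /eqP := diffopp_rcoef q; rewrite z mulr0 mulf_eq0 (negbTE den0) /= =>
    /eqP ->.
  by rewrite coef0 [X in _ * X%:R]ffact_small// mulr0.
have := congr1 (fun p : {poly R} => p`_(b + n.+1)) (diffopp_rcoef q).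
rewrite (coefM_monic_top denm dens (size_diffopp qs)) => ->.
have -> : (b + n.+1 = a + (n + e - K))%N by move: abe h; rewrite /K; lia.
rewrite (coefM_monic_top prefm prefs s3) c3.
rewrite [(n + e)%N]addnC (coefM_monic_top Vm Vs s1) c1.
rewrite [(n.+1 + k)%N]addnC (coefM_monic_top Um Us qs).
by rewrite addnC !mulr_natr -!mulrnA.
Qed.

End ReducedOperators.

(** * The integral as a functional on polynomials *)

Section Integral.
Variable R : realFieldType.
Implicit Types (p q f g Z : {poly R}) (x y c : R).

(** The antiderivative with constant term 0: at index 0 the division by 0 gives 0 by convention. *)
Definition prim p : {poly R} := \poly_(i < (size p).+1) (p`_i.-1 / i%:R).

Lemma coef_prim p i : (prim p)`_i = p`_i.-1 / i%:R.
Proof.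
rewrite coef_poly; case: ltnP => // h.
by rewrite nth_default ?mul0r//; case: i h.
Qed.

Lemma deriv_prim p : (prim p)^`() = p.
Proof.
apply/polyP => i; rewrite coef_deriv coef_prim -[LHS]mulr_natr divfK//.
Qed.

Lemma prim_deriv p : prim p^`() = p - (p`_0)%:P.
Proof.
apply/polyP => -[|i]; rewrite coef_prim coefB coefC /=.
  by rewrite invr0 mulr0 subrr.
by rewrite coef_deriv subr0 -[_ *+ _]mulr_natr mulfK// pnatr_eq0.
Qed.

Definition integ x y p := (prim p).[y] - (prim p).[x].

Lemma integ_deriv x y p : integ x y p^`() = p.[y] - p.[x].
Proof. by rewrite /integ prim_deriv !hornerD !hornerN !hornerC; ring. Qed.

Lemma primD p q : prim (p + q) = prim p + prim q.
Proof. by apply/polyP => i; rewrite coefD !coef_prim coefD mulrDl. Qed.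

Lemma primZ c p : prim (c *: p) = c *: prim p.
Proof. by apply/polyP => i; rewrite coefZ !coef_prim coefZ mulrA. Qed.

Lemma integD x y p q : integ x y (p + q) = integ x y p + integ x y q.
Proof. by rewrite /integ primD !hornerD; ring. Qed.

Lemma integZ x y c p : integ x y (c *: p) = c * integ x y p.
Proof. by rewrite /integ primZ !hornerZ; ring. Qed.

Lemma integ0 x y : integ x y 0 = 0.
Proof. by rewrite -(scale0r 0) integZ mul0r. Qed.

Lemma integ_swap x y p : integ x y p = - integ y x p.
Proof. by rewrite /integ opprB. Qed.

Lemma integ_byparts x y f Z :
  integ x y (f * Z^`()) = (f * Z).[y] - (f * Z).[x] - integ x y (f^`() * Z).
Proof. by rewrite -integ_deriv derivM integD; ring. Qed.

Definition bdry K f Z c :=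
  \sum_(i < K) (-1) ^+ i * (f^`(i)).[c] * (Z^`(K.-1 - i)).[c].

Lemma integ_byparts_iter x y K f Z :
  integ x y (f * Z^`(K)) =
  bdry K f Z y - bdry K f Z x + (-1) ^+ K * integ x y (f^`(K) * Z).
Proof.
elim: K f => [|K IH] f.
  by rewrite /bdry !big_ord0 subrr add0r mul1r.
rewrite derivnS integ_byparts IH derivSn.
have E c : bdry K.+1 f Z c = (f * Z^`(K)).[c] - bdry K f^`() Z c.
  rewrite /bdry big_ord_recl expr0 mul1r subn0 hornerM -sumrN; congr (_ + _).
  apply: eq_bigr => i _; rewrite -derivSn exprS mulN1r !mulNr /=.
  by rewrite /bump /= add1n subnS predn_sub.
by rewrite !E exprS; ring.
Qed.

Lemma derivn_XsubC_mul c i f :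
  (('X - c%:P) * f)^`(i) = ('X - c%:P) * f^`(i) + f^`(i.-1) *+ i.
Proof.
elim: i => [|i IH]; first by rewrite !derivn0 mulr0n addr0.
rewrite derivnS IH derivD derivM derivXsubC mul1r derivMn -!derivnS.
case: i {IH} => [|i] /=; first by rewrite mulr0n addr0 addrC mulr1n.
by rewrite addrAC -mulrS addrC.
Qed.

(** In the Leibniz expansion only the terms that differentiate all [m] factors [X - c] survive at
    [c]. *)
Lemma horner_derivn_XsubC_exp c m i f :
  (((('X - c%:P) ^+ m * f)^`(i)).[c] = (f^`(i - m)).[c] *+ i ^_ m)%R.
Proof.
elim: m i => [|m IH] i; first by rewrite expr0 mul1r subn0 ffactn0.
rewrite exprS -mulrA derivn_XsubC_mul hornerD hornerM hornerXsubC subrr mul0r.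
rewrite add0r hornerMn IH -mulrnA; case: i => [|i]; first by rewrite muln0.
by rewrite ffactnS subSS mulnC.
Qed.

Lemma bdry_eq0 K f Z c n : (K <= n)%N -> bdry K f (('X - c%:P) ^+ n * Z) c = 0.
Proof.
move=> Kn; apply: big1 => i _; rewrite [X in _ * X]horner_derivn_XsubC_exp.
by rewrite ffact_small ?mulr0n ?mulr0//; have := ltn_ord i; lia.
Qed.

(** With zeros of order [m] and [n] at [c] and [m + n] derivatives to share, only the split [i = m]
    leaves both factors possibly nonzero. *)
Lemma bdryE m n f Z c :
  bdry (m + n).+1 (('X - c%:P) ^+ m * f) (('X - c%:P) ^+ n * Z) c =
  (-1) ^+ m * (m`! * n`!)%:R * f.[c] * Z.[c].
Proof.
have mlt : (m < (m + n).+1)%N by rewrite ltnS leq_addr.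
rewrite /bdry (bigD1 (Ordinal mlt))//= big1 ?addr0 => [|i im].
  rewrite !horner_derivn_XsubC_exp addKn !subnn !ffactnn !derivn0 natrM.
  by rewrite -[f.[c] *+ _]mulr_natr -[Z.[c] *+ _]mulr_natr; ring.
rewrite !horner_derivn_XsubC_exp.
have [h|h|h] := ltngtP i m.
- by rewrite [X in _ * (_ *+ X) * _]ffact_small// mulr0n mulr0 mul0r.
- rewrite [X in _ * (_ *+ X)]ffact_small ?mulr0n ?mulr0//.
  by have := ltn_ord i; lia.
- by case/eqP: im; apply: val_inj.
Qed.

End Integral.

(** * Jacobi polynomials and their orthogonality *)

Lemma integ_ge0 (R : rcfType) (x y : R) (p : {poly R}) : x < y ->
  (forall z, x < z < y -> 0 <= p.[z]) -> 0 <= integ x y p.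
Proof.
move=> xy p0; rewrite subr_ge0.
apply: (@polyrcf.ler_hornerW _ x y); rewrite ?in_itv /= ?lexx ?(ltW xy)// => z.
by rewrite deriv_prim in_itv /=; exact: p0.
Qed.

(** The antiderivative is monotone with equal end values, hence constant on the interval, hence a
    constant polynomial. *)
Lemma integ_ge0_eq0 (R : rcfType) (x y : R) (p : {poly R}) : x < y ->
  (forall z, x < z < y -> 0 <= p.[z]) -> integ x y p = 0 -> p = 0.
Proof.
move=> xy p0 /eqP; rewrite /integ subr_eq0 => /eqP Gxy.
have Gmono : {in `[x, y] &, {homo horner (prim p) : s t / s <= t}}.
  apply: polyrcf.ler_hornerW => z; rewrite deriv_prim in_itv /=; exact: p0.
have Gcst z : x <= z <= y -> (prim p).[z] = (prim p).[x].
  move=> /andP[xz zy]; apply/eqP; rewrite eq_le.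
  by rewrite -{1}Gxy !Gmono// !in_itv /= ?lexx ?xz ?zy ?(ltW xy).
have : prim p - (prim p).[x]%:P = 0.
  pose q := prim p - (prim p).[x]%:P.
  (* These are [size q] distinct points of the interval, more roots than a nonzero [q] can have. *)
  apply: (@roots_geq_poly_eq0 _ _ [seq x + (y - x) / i.+1%:R | i <- iota 0
    (size q)]).
  - apply/allP => _ /mapP[i _ ->]; apply/rootP.
    rewrite hornerD hornerN hornerC Gcst ?subrr//.
    have yx : 0 < y - x by rewrite subr_gt0.
    rewrite lerDl divr_ge0 ?ler0n ?(ltW yx)//= -lerBrDl.
    by rewrite ler_pdivrMr ?ltr0n// ler_peMr ?(ltW yx)// ler1n.
  - rewrite map_inj_uniq ?iota_uniq// => i j /addrI.
    have yx : y - x != 0 by rewrite subr_eq0 gt_eqF.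
    by move/(mulfI yx)/invr_inj/eqP; rewrite eqr_nat => /eqP[].
  - by rewrite size_map size_iota.
by move/(congr1 deriv); rewrite derivB deriv_prim derivC subr0 deriv0.
Qed.

Section JacobiPolynomials.
Variable R : realFieldType.
Implicit Types (c : R) (f g p q : {poly R}) (n a b : nat).

(** For [c = 1] the classical expansion of the Jacobi polynomial in powers of (x-1)/2 and (x+1)/2.
    Keeping the end point [c] as a parameter makes the reflection of the interval an exchange of [a]
    and [b]. *)
Definition jacobip c n a b : {poly R} :=
  2^-1 ^+ n *: \sum_(s < n.+1) ('C(n + a, n - s) * 'C(n + b, s))%:R *:
    (('X - c%:P) ^+ s * ('X + c%:P) ^+ (n - s)).

Lemma jacobipN c n a b : jacobip (- c) n a b = jacobip c n b a.
Proof.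
rewrite /jacobip; congr (_ *: _).
rewrite (reindex_inj rev_ord_inj) /=; apply: eq_bigr => s _.
have sn : (s <= n)%N by rewrite -ltnS.
rewrite subSS subKn// mulnC; congr (_ *: _).
by rewrite mulrC polyCN opprK.
Qed.

Lemma derivn_XsubC_exp c m i :
  (('X - c%:P) ^+ m)^`(i) = ('X - c%:P) ^+ (m - i) *+ m ^_ i.
Proof.
elim: i => [|i IH]; first by rewrite derivn0 subn0 ffactn0.
rewrite derivnS IH derivMn deriv_exp derivXsubC mul1r -mulrnA.
by rewrite subnS ffactnSr mulnC.
Qed.

Lemma derivn_XaddC_exp c m i :
  (('X + c%:P) ^+ m)^`(i) = ('X + c%:P) ^+ (m - i) *+ m ^_ i.
Proof. by have := derivn_XsubC_exp (- c) m i; rewrite polyCN opprK. Qed.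

Lemma size_exp_XaddC n c : size (('X + c%:P) ^+ n) = n.+1.
Proof. by rewrite -[c]opprK polyCN size_exp_XsubC. Qed.

Lemma derivnM n p q :
  (p * q)^`(n) = \sum_(i < n.+1) (p^`(n - i) * q^`(i)) *+ 'C(n, i).
Proof.
elim: n => [|n IH]; first by rewrite big_ord1 !derivn0 bin0.
rewrite derivnS IH raddf_sum /=.
under eq_bigr do rewrite derivMn derivM -!derivnS mulrnDl.
rewrite big_split /= [RHS]big_ord_recl /= bin0 ?subn0.
under [in RHS]eq_bigr do rewrite /bump /= add1n subSS binS mulrnDr.
rewrite big_split /= addrA; congr (_ + _).
rewrite [in RHS]big_ord_recr /= bin_small// mulr0n addr0.
rewrite big_ord_recl /= subn0 bin0; congr (_ + _).
by apply: eq_bigr => i _; rewrite /bump /= add1n -derivnS subnSK.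
Qed.

(** Rodrigues' formula, by the Leibniz rule: the falling factorials combine into the binomials of
    [jacobip]. *)
Lemma jacobip_rodrigues c n a b :
  (('X - c%:P) ^+ (n + a) * ('X + c%:P) ^+ (n + b))^`(n) =
  (2 ^+ n * n`!%:R) *: (('X - c%:P) ^+ a * ('X + c%:P) ^+ b * jacobip c n a b).
Proof.
rewrite derivnM /jacobip -scalerAr scalerA mulrAC -exprMn divff ?pnatr_eq0//.
rewrite expr1n mul1r mulr_sumr scaler_sumr; apply: eq_bigr => s _.
have sn : (s <= n)%N by rewrite -ltnS.
rewrite derivn_XsubC_exp derivn_XaddC_exp -scalerAr scalerA -natrM scaler_nat.
rewrite mulrnAl mulrnAr -!mulrnA.
have -> : (n + a - (n - s) = a + s)%N by lia.
have -> : (n + b - s = b + (n - s))%N by lia.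
rewrite !exprD mulrACA; congr (_ *+ _).
rewrite -!bin_ffact -(bin_fact sn); ring.
Qed.

Section Orthogonality.
Variable c : R.
Hypothesis c2 : c ^+ 2 = 1.
Let u := 'X - c%:P.
Let v := 'X + c%:P.

(** By Rodrigues' formula and [n] integrations by parts; the two powers have zeros of order at least
    [n] at the end points, so no boundary term remains. *)
Lemma integ_jacobip n a b g :
  integ (- c) c (u ^+ a * v ^+ b * jacobip c n a b * g) =
  (- 2^-1) ^+ n / n`!%:R * integ (- c) c (g^`(n) * (u ^+ (n + a) * v ^+ (n +
    b))).
Proof.
have n0 : 2 ^+ n * n`!%:R != 0 :> R.
  by rewrite mulf_neq0 ?expf_neq0 ?pnatr_eq0// -lt0n fact_gt0.
have := integ_byparts_iter (- c) c n g (u ^+ (n + a) * v ^+ (n + b)).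
rewrite bdry_eq0 ?leq_addr// mulrC [u ^+ _ * _]mulrC.
have vE : v = 'X - (- c)%:P by rewrite polyCN opprK.
rewrite {2}vE bdry_eq0 ?leq_addr// subrr add0r.
rewrite mulrC [v ^+ _ * _]mulrC jacobip_rodrigues -/u -/v -scalerAr integZ.
rewrite [g * _]mulrC => /(canRL (mulKf n0)) ->.
by rewrite invfM [(- 2^-1) ^+ n]exprNn exprVn; ring.
Qed.

(** The beta integral, by induction on [a]: an integration by parts trades one factor [u] for one
    factor [v]. *)
Lemma integ_beta a b :
  integ (- c) c (u ^+ a * v ^+ b) =
  (-1) ^+ a * (2 * c) ^+ (a + b).+1 * (a`! * b`!)%:R / (a + b).+1`!%:R.
Proof.
have dv m : (v ^+ m.+1)^`() = m.+1%:R *: v ^+ m.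
  by rewrite deriv_exp derivD derivX derivC addr0 mul1r scaler_nat.
have du m : (u ^+ m.+1)^`() = m.+1%:R *: u ^+ m.
  by rewrite deriv_exp derivXsubC mul1r scaler_nat.
have nz m : m.+1%:R != 0 :> R by rewrite pnatr_eq0.
have fz m : m`!%:R != 0 :> R by rewrite pnatr_eq0 -lt0n fact_gt0.
have vN : v.[- c] = 0 by rewrite /v !hornerE addNr.
have uc : u.[c] = 0 by rewrite /u !hornerE subrr.
elim: a b => [|a IH] b.
  apply: (mulfI (nz b)); rewrite expr0 mul1r -integZ -dv integ_deriv
    !horner_exp.
  rewrite vN expr0n subr0 add0n expr0 mul1r fact0 mul1n.
  have -> : v.[c] = 2 * c by rewrite /v !hornerE; ring.
  by rewrite factS natrM; field; rewrite fz nat1r nz.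
apply: (mulfI (nz b)); rewrite -integZ scalerAr -dv integ_byparts.
rewrite !hornerM !horner_exp vN uc !expr0n !(mul0r, mulr0) subrr sub0r.
rewrite du -scalerAl integZ IH addSn addnS.
move: (fz (a + b).+2); move: (((a + b).+2)`!)%:R => F F0.
by rewrite [a.+1`!]factS [b.+1`!]factS !natrM [_ ^+ a.+1]exprS; field.
Qed.

Lemma size_jacobip n a b : (size (jacobip c n a b) <= n.+1)%N.
Proof.
rewrite /jacobip (leq_trans (size_scale_leq _ _))//.
apply: (leq_trans (size_sum _ _ _)); apply/bigmax_leqP => s _.
rewrite (leq_trans (size_scale_leq _ _))//.
rewrite size_monicM ?monic_exp ?monicXsubC ?monic_neq0 ?monic_exp ?monicXaddC//.
by rewrite size_exp_XaddC size_exp_XsubC addSn /= addnS subnKC// -ltnS.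
Qed.

(** Each product of powers is monic, so the leading coefficient is a Vandermonde sum. *)
Lemma jacobip_lead n a b : (jacobip c n a b)`_n = 2^-1 ^+ n * 'C(2 * n + a + b,
  n)%:R.
Proof.
rewrite /jacobip coefZ coef_sum; congr (_ * _).
have -> : (2 * n + a + b = (n + b) + (n + a))%N by lia.
rewrite -binomial.Vandermonde natr_sum; apply: eq_bigr => s _.
rewrite coefZ mulnC; have sn : (s <= n)%N by rewrite -ltnS.
have : u ^+ s * v ^+ (n - s) \is monic.
  by rewrite monicMl ?monic_exp ?monicXsubC ?monicXaddC.
move/monicP; rewrite lead_coefE size_monicM ?monic_neq0 ?monic_exp ?monicXsubC
  ?monicXaddC//.
by rewrite size_exp_XaddC size_exp_XsubC addSn /= addnS /= subnKC// => ->;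
  rewrite mulr1.
Qed.

Lemma jacobip_horner n a b : (jacobip c n a b).[c] = c ^+ n * 'C(n + a, n)%:R.
Proof.
rewrite /jacobip hornerZ horner_sum big_ord_recl big1 ?addr0 => [|i _].
  rewrite subn0 bin0 muln1 expr0 mul1r hornerZ horner_exp !hornerE.
  have -> : c + c = 2 * c by ring.
  rewrite exprMn /= mulrAC mulrA -exprMn mulVf ?pnatr_eq0//.
  by rewrite expr1n mul1r.
by rewrite hornerZ hornerM horner_exp hornerXsubC subrr expr0n /= mul0r mulr0.
Qed.

End Orthogonality.

Lemma jacobip_hornerN c n a b :
  (jacobip c n a b).[- c] = (- c) ^+ n * 'C(n + b, n)%:R.
Proof. by rewrite -jacobipN jacobip_horner. Qed.

End JacobiPolynomials.

(** * Koornwinder's polynomials are orthogonal *)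

Section KoornwinderPolynomials.
Variable R : realFieldType.
Implicit Types (c M N : R) (f g p q : {poly R}) (m n a b : nat).

Lemma fact_neq0 n : n`!%:R != 0 :> R.
Proof. by rewrite pnatr_eq0 -lt0n fact_gt0. Qed.

Lemma natr_factS n : n.+1`!%:R = n.+1%:R * n`!%:R :> R.
Proof. by rewrite factS natrM. Qed.

Lemma natr_bin m n : 'C(n + m, n)%:R = (n + m)`!%:R / (n`!%:R * m`!%:R) :> R.
Proof.
have /(congr1 (fun k => k%:R : R)) := bin_fact (leq_addr m n).
by rewrite addKn !natrM => <-; field; rewrite !fact_neq0.
Qed.

Lemma derivn_const p n : (size p <= n.+1)%N -> p^`(n) = (p`_n *+ n`!)%:P.
Proof.
move=> ps; have [s1] := coef_derivn_top n ps.
by rewrite ffactnn subnn => <-; apply: size1_polyC; rewrite subnn in s1.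
Qed.

Section Point.
Variable c : R.
Hypothesis c2 : c ^+ 2 = 1.
Let u := 'X - c%:P.
Let v := 'X + c%:P.

Lemma sqr1_neq0 : c != 0.
Proof. by apply: contraTneq (oner_neq0 R) => c0; rewrite -c2 c0 expr0n eqxx.
  Qed.

Lemma sqr1_expr n : c ^+ n * c ^+ n = 1.
Proof. by rewrite -exprMn -expr2 c2 expr1n. Qed.

Lemma signrr n : (-1) ^+ n * (-1) ^+ n = 1 :> R.
Proof. by rewrite -exprMn mulrNN mul1r expr1n. Qed.

Lemma integ_jacobip_lead n a b g : (size g <= n.+1)%N ->
  integ (- c) c (u ^+ a * v ^+ b * jacobip c n a b * g) =
  (- 2^-1) ^+ n * g`_n * integ (- c) c (u ^+ (n + a) * v ^+ (n + b)).
Proof.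
move=> gs; rewrite integ_jacobip// (derivn_const gs) mul_polyC integZ.
by rewrite -[g`_n *+ _]mulr_natr; field; rewrite fact_neq0.
Qed.

Lemma integ_jacobip_eq0 n a b g : (size g <= n)%N ->
  integ (- c) c (u ^+ a * v ^+ b * jacobip c n a b * g) = 0.
Proof.
move=> gs; rewrite integ_jacobip_lead ?nth_default ?mulr0 ?mul0r//.
exact: leqW.
Qed.

(* Modulo multiples of v, on which the integral vanishes, g may be replaced by
   a multiple of the Jacobi polynomial for the weight u^a v^(b+1). *)
Lemma integ_jacobip_shift m a b g : (size g <= m.+1)%N ->
  integ (- c) c (u ^+ a * v ^+ b.+1 * jacobip c m a b.+2 * g) =
  g.[- c] * ((-1) ^+ (a + m) * c ^+ (a + b + m) * 2 ^+ (a + b).+2 *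
    ((a + m)`!%:R * b.+1`!%:R) / ((a + b + m).+2)`!%:R).
Proof.
move=> gs; pose t := jacobip c m a b.+1; set J := jacobip _ _ _ _.
have tc : t.[- c] = (- c) ^+ m * 'C(m + b.+1, m)%:R by rewrite jacobip_hornerN.
have t0 : t.[- c] != 0.
  rewrite tc mulf_neq0 ?expf_neq0 ?oppr_eq0 ?sqr1_neq0//.
  by rewrite pnatr_eq0 -lt0n bin_gt0 leq_addr.
pose k := g.[- c] / t.[- c].
have : root (g - k *: t) (- c).
  by apply/rootP; rewrite hornerD hornerN hornerZ divfK// subrr.
case/factor_theorem => q Hq; rewrite polyCN opprK -/v in Hq.
have qs : (size q <= m)%N.
  have : (size (q * v)%R <= m.+1)%N.
    rewrite -Hq (leq_trans (size_polyD _ _))// geq_max gs size_polyN.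
    by rewrite (leq_trans (size_scale_leq _ _))// size_jacobip.
  have [->|q0] := eqVneq q 0; first by rewrite size_poly0.
  by rewrite size_Mmonic ?monicXaddC// size_XaddC addn2.
have -> : g = k *: t + q * v by rewrite -Hq; ring.
(* In the first summand the roles are exchanged: [t] is the Jacobi polynomial of the weight and [J]
   the test polynomial. In the second, [v] completes the weight of [J], and the degree of [q] makes
   the integral vanish. *)
have -> : u ^+ a * v ^+ b.+1 * J * (k *: t + q * v) =
    k *: (u ^+ a * v ^+ b.+1 * t * J) + u ^+ a * v ^+ b.+2 * J * q.
  by rewrite mulrDr -scalerAr exprS [v ^+ b.+2]exprS exprS; congr (_ *: _ + _);
    ring.
rewrite integD integ_jacobip_eq0// addr0 integZ.
rewrite integ_jacobip_lead ?size_jacobip// jacobip_lead integ_beta//.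
rewrite hornerD hornerZ hornerM -/t.
have -> : v.[- c] = 0 by rewrite /v !hornerE addNr.
rewrite mulr0 addr0 /k mulrVK ?unitfE//.
have -> : (2 * m + a + b.+2 = m + (m + a + b.+2))%N by lia.
rewrite tc !natr_bin.
have -> : (m + a + (m + b.+1)).+1 = (m + (m + a + b.+2))%N by lia.
have -> : (m + a + b.+2 = (a + b + m).+2)%N by lia.
have E : (2 * c) ^+ (m + (a + b + m).+2) =
    2 ^+ m * 2 ^+ m * 2 ^+ (a + b).+2 * (c ^+ m * c ^+ m * c ^+ (a + b)).
  have -> : (m + (a + b + m).+2 = m + m + (a + b) + 2)%N by lia.
  by rewrite exprMn -[(a + b).+2]addn2 !exprD c2; ring.
rewrite {}E [(- 2^-1) ^+ m]exprNn [(- c) ^+ m]exprNn !exprVn !exprD.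
rewrite [((m + a)`! * _)%:R]natrM [(m + a)%N]addnC.
rewrite [c ^+ a * c ^+ b]mulrC.
have e0 : (-1) ^+ m != 0 :> R by rewrite signr_eq0.
have q0 : c ^+ m != 0 by rewrite expf_neq0 ?sqr1_neq0.
have w0 : 2 ^+ m != 0 :> R by rewrite expf_neq0 ?pnatr_eq0.
move: (fact_neq0 m) (fact_neq0 b.+1) (fact_neq0 (m + b.+1))
  (fact_neq0 (a + b + m).+2) (fact_neq0 (m + (a + b + m).+2)).
move: (m`!%:R) (b.+1`!%:R) ((m + b.+1)`!%:R) ((a + b + m).+2`!%:R)
  ((m + (a + b + m).+2)`!%:R) ((a + m)`!%:R).
move: ((-1) ^+ m) ((-1) ^+ a) (c ^+ m) (c ^+ a) (c ^+ b) (2 ^+ m)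
  (2 ^+ (a + b).+2) e0 q0 w0.
by move=> *; field; do !(apply/andP; split).
Qed.

End Point.

(** The reciprocal of the integral of (1-x)^a (1+x)^b over [-1,1]. *)
Definition jweight a b : R := (a + b).+1`!%:R / (2 ^+ (a + b).+1 * a`!%:R *
  b`!%:R).

(* The normalised Jacobi integral; the sign makes it invariant under
   (c, a, b) |-> (-c, b, a), so that c = 1 and c = -1 treat the two end points
   alike. *)
Definition jform c a b f := jweight a b * (- c) ^+ a * c ^+ b.+1 *
  integ (- c) c (('X - c%:P) ^+ a * ('X + c%:P) ^+ b * f).

Lemma jformN c a b f : jform (- c) a b f = jform c b a f.
Proof.
rewrite /jform /jweight polyCN !opprK integ_swap [X in integ _ _ (X * _)]mulrC.
by rewrite [(b + a)%N]addnC !invfM !exprS; ring.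
Qed.

Lemma jformD c a b f g : jform c a b (f + g) = jform c a b f + jform c a b g.
Proof. by rewrite /jform [X in integ _ _ X]mulrDr integD mulrDr. Qed.

Lemma jformZ c a b k f : jform c a b (k *: f) = k * jform c a b f.
Proof. by rewrite /jform -scalerAr integZ; ring. Qed.

(** Here and in [ks], Koornwinder's constants q of index [m.+1] and s of index [m.+2], with
    Pochhammer symbols as quotients of factorials; r is [kq] with [a] and [b] exchanged. *)
Definition kq m a b : R :=
  ((a + b + m).+2`!%:R * (b + m).+1`!%:R * a`!%:R) /
  (2 * m.+1`!%:R * (a + b).+1`!%:R * b.+1`!%:R * (a + m)`!%:R).

Definition ks m a b : R :=
  ((a + b + m).+3`!%:R * (a + b + m).+4`!%:R) /
  (4 * a.+1%:R * b.+1%:R * m.+1`!%:R * m.+2`!%:R * (a + b).+1`!%:R ^+ 2).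

(* kQ 1 n alpha beta is Q_n, and kQ (-1) n beta alpha is R_n. *)
Definition kQ c n a b : {poly R} :=
  if n is m.+1 then kq m a b *: (('X + c%:P) * jacobip c m a b.+2) else 0.

Definition kS c n a b : {poly R} :=
  if n is m.+2 then ks m a b *: (('X^2 - 1) * jacobip c m a.+2 b.+2) else 0.

Lemma kSN c n a b : kS (- c) n a b = kS c n b a.
Proof.
case: n => [|[|m]]//=; rewrite jacobipN /ks [(b + a)%N]addnC; congr (_ *: _).
by congr (_ / _); ring.
Qed.

Section EndPoint.
Variable c : R.
Hypothesis c2 : c ^+ 2 = 1.

(** The factor [X + c] raises the weight exponent at [-c], so [integ_jacobip_shift] applies. The
    constant [kq] is such that the result cancels the point mass at [-c] applied to the Jacobi
    polynomial. *)
Lemma jform_kQ n a b g : (size g <= n)%N ->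
  jform c a b (kQ c n a b * g) = - (jacobip c n a b * g).[- c].
Proof.
case: n => [|m gs].
  rewrite size_poly_leq0 => /eqP ->; rewrite /jform !mulr0 integ0 mulr0.
  by rewrite horner0 oppr0.
rewrite /kQ -scalerAl jformZ /jform.
have -> : ('X - c%:P) ^+ a * ('X + c%:P) ^+ b *
    (('X + c%:P) * jacobip c m a b.+2 * g) =
    ('X - c%:P) ^+ a * ('X + c%:P) ^+ b.+1 * jacobip c m a b.+2 * g.
  by rewrite exprS; ring.
rewrite integ_jacobip_shift// hornerM jacobip_hornerN natr_bin /kq /jweight.
have -> : (m.+1 + b = (b + m).+1)%N by lia.
have -> : (- c) ^+ m.+1 = - ((- c) ^+ a * c ^+ b.+1 * (-1) ^+ (a + m) * c ^+ (a
  + b + m)).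
  rewrite ![(- c) ^+ _]exprNn !exprD !exprS.
  rewrite [RHS](_ : _ = - ((-1) ^+ a * (-1) ^+ a * (c ^+ a * c ^+ a)
    * (c ^+ b * c ^+ b) * ((-1) ^+ m * (c * c ^+ m)))); last by ring.
  by rewrite signrr !sqr1_expr//; ring.
rewrite [2 ^+ (a + b).+2]exprS.
have w0 : 2 ^+ (a + b).+1 != 0 :> R by rewrite expf_neq0 ?pnatr_eq0.
move: (fact_neq0 m.+1) (fact_neq0 b.+1) (fact_neq0 b) (fact_neq0 a)
  (fact_neq0 (a + b).+1) (fact_neq0 (a + m)) (fact_neq0 (a + b + m).+2) w0.
move: (m.+1`!%:R) (b.+1`!%:R) (b`!%:R) (a`!%:R) ((a + b).+1`!%:R)
  ((a + m)`!%:R) ((a + b + m).+2`!%:R) ((b + m).+1`!%:R) (2 ^+ (a + b).+1).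
move: ((-1) ^+ (a + m)) (c ^+ (a + b + m)) (c ^+ b.+1) ((- c) ^+ a).
by move=> *; field; do !(apply/andP; split).
Qed.

(** The root of the test polynomial and the factor [X^2 - 1] complete the weight to
    [u^(a+2) v^(b+1)], which is again a case of [integ_jacobip_shift]. *)
Lemma jform_kS_root m a b g : (size g <= m.+1)%N ->
  jform c a b (kS c m.+2 a b * (('X - c%:P) * g)) =
  - (kQ (- c) m.+2 b a * (('X - c%:P) * g)).[- c].
Proof.
move=> gs; rewrite /kS -scalerAl jformZ /jform.
have -> : ('X - c%:P) ^+ a * ('X + c%:P) ^+ b *
    (('X^2 - 1) * jacobip c m a.+2 b.+2 * (('X - c%:P) * g)) =
    ('X - c%:P) ^+ a.+2 * ('X + c%:P) ^+ b.+1 * jacobip c m a.+2 b.+2 * g.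
  have -> : 'X^2 - 1 = ('X - c%:P) * ('X + c%:P) :> {poly R}.
    by rewrite -subr_sqr -rmorphXn /= c2.
  by rewrite !exprS; ring.
rewrite integ_jacobip_shift// /kQ hornerM hornerZ hornerM jacobip_horner
  natr_bin.
rewrite hornerM !hornerD !hornerN hornerX !hornerC.
have -> : kq m.+1 b a = ((a + b + m).+3`!%:R * (a.+2 + m)`!%:R * b`!%:R) /
    (2 * m.+2`!%:R * (a + b).+1`!%:R * a.+1`!%:R * (b + m.+1)`!%:R).
  rewrite /kq; have -> : (b + a + m.+1 = (a + b + m).+1)%N by lia.
  have -> : ((a + m.+1).+1 = a.+2 + m)%N by lia.
  by rewrite [(b + a)%N]addnC.
have -> : (m.+1 + b = b + m.+1)%N by lia.
have -> : ((a.+2 + b + m).+2 = (a + b + m).+4)%N by lia.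
have -> : 2 ^+ (a.+2 + b).+2 = 2 ^+ (a + b).+1 * 8 :> R.
  have -> : ((a.+2 + b).+2 = (a + b).+1 + 3)%N by lia.
  by rewrite exprD; ring.
have sg : (- c) ^+ a * c ^+ b.+1 * (-1) ^+ (a.+2 + m) * c ^+ (a.+2 + b + m) =
    - (- c) ^+ m.+1.
  rewrite ![(- c) ^+ _]exprNn !exprD !exprS.
  rewrite [LHS](_ : _ = (-1) ^+ a * (-1) ^+ a * (c ^+ a * c ^+ a)
    * (c ^+ b * c ^+ b) * ((-1) ^+ m * (c * c ^+ m)) * c ^+ 2); last by ring.
  by rewrite signrr !sqr1_expr// c2; ring.
have sc : (- c) ^+ m.+1 * (- c - c) * (- c - c) = 4 * (- c) ^+ m.+1.
  rewrite [LHS](_ : _ = 4 * (- c) ^+ m.+1 * c ^+ 2); last by ring.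
  by rewrite c2 mulr1.
rewrite /ks /jweight [a.+1`!]factS [b.+1`!]factS.
move: sg sc; move: ((- c) ^+ a) (c ^+ b.+1) ((-1) ^+ (a.+2 + m))
  (c ^+ (a.+2 + b + m)) ((- c) ^+ m.+1) (- c - c) g.[- c] => s1 s2 s3 s4 S S2
    gc sg sc.
rewrite [(a.+1 * _)%:R]natrM [(b.+1 * _)%:R]natrM.
have a0 : a.+1%:R != 0 :> R by rewrite pnatr_eq0.
have b0 : b.+1%:R != 0 :> R by rewrite pnatr_eq0.
have w0 : 2 ^+ (a + b).+1 != 0 :> R by rewrite expf_neq0 ?pnatr_eq0.
move: (fact_neq0 m.+1) (fact_neq0 m.+2) (fact_neq0 b) (fact_neq0 a)
  (fact_neq0 (a + b).+1) (fact_neq0 (a + b + m).+4) (fact_neq0 (b + m.+1)) a0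
    b0 w0.
move: (m.+1`!%:R) (m.+2`!%:R) (b`!%:R) (a`!%:R) ((a + b).+1`!%:R)
  ((a + b + m).+4`!%:R) ((b + m.+1)`!%:R) ((a + b + m).+3`!%:R)
  ((a.+2 + m)`!%:R) (2 ^+ (a + b).+1) (a.+1%:R) (b.+1%:R).
move=> M1 M2 B A AB F4 BM F3 AM W X1 Y1 *.
transitivity (F3 * AM * 2 * gc / (X1 * M1 * M2 * AB * A) * (s1 * s2 * s3 * s4)).
  by field; do !(apply/andP; split).
transitivity (- (F3 * AM * gc / (2 * X1 * M1 * M2 * AB * A) * (S * S2 * S2))).
  by rewrite sg sc; field; do !(apply/andP; split).
by field; do !(apply/andP; split).
Qed.

Lemma kQ1 a b : kQ c 1 a b = (a + b).+2%:R / 2 *: ('X + c%:P).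
Proof.
rewrite /kQ; have -> : jacobip c 0 a b.+2 = 1.
  by rewrite /jacobip big_ord1 !expr0 !mul1r !bin0 !scale1r.
rewrite mulr1 /kq !addn0 [((a + b).+2)`!]factS natrM; congr (_ *: _).
have -> : 1`!%:R = 1 :> R by [].
move: (fact_neq0 a) (fact_neq0 b.+1) (fact_neq0 (a + b).+1).
move: (a`!%:R) (b.+1`!%:R) ((a + b).+1`!%:R) => x y z x0 y0 z0.
by field; do !(apply/andP; split).
Qed.

End EndPoint.

Lemma sqrN1 : (-1) ^+ 2 = 1 :> R. Proof. by rewrite sqrrN expr1n. Qed.

(** This makes the terms in [M * N] of the bilinear form cancel: there Q_n meets the point mass at 1
    and R_n the one at -1. *)
Lemma jform_kS n a b g : (size g <= n)%N ->
  jform 1 a b (kS 1 n a b * g) =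
  - (kQ 1 n a b * g).[1] - (kQ (-1) n b a * g).[- 1].
Proof.
case: n => [|[|m]] gs.
- move: gs; rewrite size_poly_leq0 => /eqP ->; rewrite /jform !mulr0 integ0
  mulr0.
  by rewrite !horner0 subr0 oppr0.
(* Here S_1 = 0 and [g] is constant, while Q_1(1) and R_1(-1) are opposite. *)
- rewrite (size1_polyC gs) /jform mul0r mulr0 integ0 mulr0 !kQ1.
  rewrite !hornerM !hornerZ !hornerC !hornerD !hornerX !hornerC [(b +
    a)%N]addnC.
  by field.
(* Subtracting the multiple of [X + 1] with the same value at 1 splits [g] into [h], with a root at
   -1, and [e], with a root at 1. *)
pose k := g.[1] / 2.
have : root (g - k *: ('X + 1%:P)) 1.
  by apply/rootP; rewrite !hornerE /k; field.
case/factor_theorem => q Hq.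
have qs : (size q <= m.+1)%N.
  have : (size (q * ('X - 1%:P))%R <= m.+2)%N.
    rewrite -Hq (leq_trans (size_polyD _ _))// geq_max gs size_polyN.
    by rewrite (leq_trans (size_scale_leq _ _))// size_XaddC.
  have [->|q0] := eqVneq q 0; first by rewrite size_poly0.
  by rewrite size_Mmonic ?monicXsubC// size_XsubC addn2.
pose h := ('X - (-1)%:P) * k%:P : {poly R}.
pose e := ('X - 1%:P) * q.
have -> : g = h + e.
  rewrite /e [_ * q]mulrC -Hq /h [_ * k%:P]mulrC mul_polyC polyCN opprK.
  by rewrite addrC subrK.
have h1 : h.[- 1] = 0 by rewrite /h hornerM hornerXsubC subrr mul0r.
have e1 : e.[1] = 0 by rewrite /e hornerM hornerXsubC subrr mul0r.
have ks : (size (k%:P : {poly R}) <= m.+1)%N.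
  by rewrite (leq_trans (size_polyC_leq1 _)).
rewrite mulrDr jformD {2}/e (jform_kS_root (expr1n _ _) _ _ qs) -/e.
rewrite -jformN -kSN (jform_kS_root sqrN1 _ _ ks) -/h opprK.
move: h e h1 e1 => h e h1 e1.
by rewrite !hornerM !hornerD h1 e1 addr0 add0r.
Qed.

Definition koornp M N n a b := jacobip 1 n a b + M *: kQ 1 n a b
  + N *: kQ (-1) n b a + (M * N) *: kS 1 n a b.

Definition kform M N a b f g :=
  jform 1 a b (f * g) + M * (f * g).[- 1] + N * (f * g).[1].

Lemma kQ_horner c n a b : (kQ c n a b).[- c] = 0.
Proof.
case: n => [|n]; first by rewrite horner0.
by rewrite hornerZ hornerM hornerD hornerX hornerC addNr mul0r mulr0.
Qed.

Lemma kS_horner c n a b z : z ^+ 2 = 1 -> (kS c n a b).[z] = 0.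
Proof.
move=> z2; case: n => [|[|n]]; rewrite ?horner0//.
by rewrite hornerZ hornerM hornerD hornerN hornerXn z2 -polyC1 hornerC subrr
  mul0r mulr0.
Qed.

(** The coefficients of 1, [M], [N] and [M * N] vanish separately by the preceding evaluations. The
    higher monomials vanish because Q_n(-1) = R_n(1) = 0 and S_n is 0 at both end points. *)
Lemma koornp_orthogonal M N n a b g : (size g <= n)%N ->
  kform M N a b (koornp M N n a b) g = 0.
Proof.
move=> gs; rewrite /kform /koornp.
have jP : jform 1 a b (jacobip 1 n a b * g) = 0.
  by rewrite /jform mulrA integ_jacobip_eq0 ?mulr0// expr1n.
have jQ := jform_kQ (expr1n _ 2) a b gs.
have jR := jform_kQ sqrN1 b a gs; rewrite jformN opprK in jR.
have jS := jform_kS a b gs.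
rewrite jacobipN in jR.
have Q0 := kQ_horner 1 n a b; have T0 := kQ_horner (-1) n b a.
rewrite opprK in T0.
have S0 := kS_horner 1 n a b sqrN1; have S1 := kS_horner 1 n a b (expr1n _ 2).
move: jP jQ jR jS Q0 T0 S0 S1.
move: (jacobip 1 n a b) (kQ 1 n a b) (kQ (-1) n b a) (kS 1 n a b) => P Q T S.
move=> jP jQ jR jS Q0 T0 S0 S1.
rewrite !mulrDl -!scalerAl !jformD !jformZ jP jQ jR jS !hornerD !hornerZ
  !hornerM.
by rewrite Q0 T0 S0 S1; ring.
Qed.

Lemma size_kQ c n a b : (size (kQ c n a b) <= n.+1)%N.
Proof.
case: n => [|n]; first by rewrite size_poly0.
rewrite (leq_trans (size_scale_leq _ _))// -[in n.+2]addn1.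
exact: size_mul_le (size_XaddC c) (size_jacobip c n a b.+2).
Qed.

Lemma size_kS c n a b : (size (kS c n a b) <= n.+1)%N.
Proof.
case: n => [|[|n]]; rewrite ?size_poly0//.
rewrite (leq_trans (size_scale_leq _ _))// -[in n.+3]addn2.
have s2 : size ('X^2 - 1 : {poly R}) = 3 by rewrite size_XnsubC.
exact: size_mul_le s2 (size_jacobip c n a.+2 b.+2).
Qed.

Lemma size_koornp M N n a b : (size (koornp M N n a b) <= n.+1)%N.
Proof.
have auz k f : (size f <= n.+1)%N -> (size (k *: f) <= n.+1)%N.
  exact: leq_trans (size_scale_leq _ _).
by rewrite /koornp !(size_polyD_le, auz, size_jacobip, size_kQ, size_kS).
Qed.

(** At -1 only P_n and R_n contribute, both with the sign (-1)^n, so nothing cancels. *)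
Lemma koornp_hornerN1_neq0 M N n a b : 0 <= N -> (koornp M N n a b).[- 1] != 0.
Proof.
move=> N0; rewrite /koornp !hornerD [(M *: _).[_]]hornerZ [(N *: _).[_]]hornerZ.
rewrite [((M * N) *: _).[_]]hornerZ (kS_horner _ _ _ _ sqrN1).
rewrite (kQ_horner 1) !mulr0 !addr0 jacobip_hornerN.
have b0 m k : 0 < 'C(m + k, m)%:R :> R by rewrite ltr0n bin_gt0 leq_addr.
have -> : (-1) ^+ n * 'C(n + b, n)%:R + N * (kQ (-1) n b a).[-1] =
    (-1) ^+ n * ('C(n + b, n)%:R +
      (if n is m.+1 then N * (2 * kq m b a * 'C(m + b, m)%:R) else 0)).
  case: n => [|m]; first by rewrite horner0 mulr0 !addr0.
  rewrite /kQ hornerZ hornerM jacobip_horner hornerD hornerX hornerC exprS.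
  by ring.
rewrite mulf_neq0 ?signr_eq0// gt_eqF// ltr_pwDl//.
case: n => // m; rewrite mulr_ge0// mulr_ge0 ?ler0n// mulr_ge0//.
by rewrite /kq divr_ge0// !mulr_ge0// ler0n.
Qed.

End KoornwinderPolynomials.

(** * The four operators on polynomials *)

Section Operators.
Variable R : realFieldType.
Implicit Types (c M N : R) (f g p q : {poly R}) (n a b : nat).

Definition coef2 a b := rcoef 1 (('X - 1%:P) ^+ a * ('X + 1%:P) ^+ b : {poly R})
  1 1 (('X - 1%:P) ^+ a.+1 * ('X + 1%:P) ^+ b.+1).

(* For c = 1 these are the coefficients of Ltilde with (a, b) = (alpha, beta),
   for c = -1 those of L4 with (a, b) = (beta, alpha). *)
Definition coef4 c a b := rcoef ('X + c%:P) (('X - c%:P) ^+ a) b.+2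
  (('X + c%:P) ^+ b.+1) (('X - c%:P) ^+ (a + b).+2).

Definition coef6 a b := rcoef ('X^2 - 1) (1 : {poly R}) (a + b).+3
  (('X - 1%:P) ^+ a.+1 * ('X + 1%:P) ^+ b.+1)
  (('X - 1%:P) ^+ b.+1 * ('X + 1%:P) ^+ a.+1).

Definition op2 a b := diffopp 2 (coef2 a b).
Definition op4 c a b := diffopp (2 * b.+2) (coef4 c a b).
Definition op6 a b := diffopp (2 * (a + b).+3) (coef6 a b).

Lemma jop1_1 (V : {poly R}) : jop 1 1 V 1%N = V^`().
Proof.
rewrite /jop /= /dstep /dzero /= deriv0 -polyC1 derivC add0r polyC1.
by rewrite !mulr1 addr0 mulr0 addr0.
Qed.

Lemma coef2_1 a b :
  coef2 a b 1%N = (a%:R - b%:R)%:P + (a%:R + b%:R + 2) *: 'X.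
Proof.
rewrite /coef2 /rcoef mul1r jop1_1.
set u := 'X - _; set v := 'X + _.
have -> : (u ^+ a.+1 * v ^+ b.+1)^`() =
    ((a%:R - b%:R)%:P + (a%:R + b%:R + 2) *: 'X) * (u ^+ a * v ^+ b).
  rewrite derivM !deriv_exp derivXsubC derivD derivX derivC addr0 !mul1r /=.
  rewrite -[u ^+ a *+ _]mulr_natr -[v ^+ b *+ _]mulr_natr -mul_polyC.
  rewrite !rmorphD rmorphN !rmorph_nat !exprS -!natr1.
  by rewrite /u /v; ring.
by rewrite mulpK// monic_neq0// monicMl ?monic_exp ?monicXsubC ?monicXaddC.
Qed.

Lemma coef2_2 a b : coef2 a b 2%N = 'X^2 - 1.
Proof.
rewrite /coef2 /rcoef mul1r (jop_top 1) mulr1.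
have -> : ('X - 1%:P) ^+ a.+1 * ('X + 1%:P) ^+ b.+1 =
   ('X^2 - 1) * (('X - 1%:P) ^+ a * ('X + 1%:P) ^+ b) :> {poly R}.
  by rewrite polyC1 !exprS; ring.
by rewrite mulpK// monic_neq0// monicMl ?monic_exp ?monicXsubC ?monicXaddC.
Qed.

Lemma op2E a b p : op2 a b p =
  ((a%:R - b%:R)%:P + (a%:R + b%:R + 2) *: 'X) * p^`() + ('X^2 - 1) * p^`()^`().
Proof.
rewrite /op2 /diffopp big_ltn// big_ltn// big_geq// addr0 coef2_1 coef2_2.
by rewrite derivn1.
Qed.

Lemma op2K a b p : ('X - 1%:P) ^+ a * ('X + 1%:P) ^+ b * op2 a b p =
  (('X - 1%:P) ^+ a.+1 * ('X + 1%:P) ^+ b.+1 * p^`())^`().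
Proof.
rewrite op2E !derivM !deriv_exp derivXsubC derivD derivX derivC addr0 !mul1r /=.
rewrite -[_ ^+ a *+ _]mulr_natr -[_ ^+ b *+ _]mulr_natr -mul_polyC.
rewrite !rmorphD rmorphN !rmorph_nat !exprS -!natr1 polyC1.
by ring.
Qed.

(** Of the [a + b + 2] factors [X - c] in [V], the outer [b + 2] derivatives leave [a]. *)
Lemma dvdp_coef4 c a b i : ('X - c%:P) ^+ a %| ('X + c%:P) *
  jop b.+2 (('X + c%:P) ^+ b.+1) (('X - c%:P) ^+ (a + b).+2) i.
Proof.
apply: dvdp_mull; apply: dvdp_exp_iter_dstep => j.
by rewrite !addnS dvdp_mulIl.
Qed.

Lemma op4K c a b p : ('X - c%:P) ^+ a * op4 c a b p = ('X + c%:P) *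
  (('X - c%:P) ^+ (a + b).+2 * (('X + c%:P) ^+ b.+1 * p)^`(b.+2))^`(b.+2).
Proof.
apply: diffopp_rcoef (dvdp_coef4 c a b) _; rewrite ?monic_exp ?monicXsubC
  ?monicXaddC//.
by rewrite size_exp_XaddC.
Qed.

Lemma monic_XsubC_XaddC c a b :
  ('X - c%:P) ^+ a * ('X + c%:P) ^+ b \is monic.
Proof. by rewrite monicMl ?monic_exp ?monicXsubC ?monicXaddC. Qed.

Lemma size_XsubC_XaddC c a b :
  size (('X - c%:P) ^+ a * ('X + c%:P) ^+ b) = (a + b).+1.
Proof.
rewrite size_monicM ?monic_neq0 ?monic_exp ?monicXsubC ?monicXaddC//.
by rewrite size_exp_XsubC size_exp_XaddC addnS.
Qed.

Lemma dvdp_coef2 a b i : ('X - 1%:P) ^+ a * ('X + 1%:P) ^+ b %| 1 *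
  jop 1 1 (('X - 1%:P) ^+ a.+1 * ('X + 1%:P) ^+ b.+1 : {poly R}) i.
Proof.
have -> : 'X + 1%:P = 'X - (-1)%:P :> {poly R} by rewrite polyCN opprK.
have cop : coprimep (('X - 1%:P) ^+ a) (('X - (-1)%:P) ^+ b : {poly R}).
  apply/coprimep_expl/coprimep_expr/coprimep_XsubC2.
  by rewrite lt_eqF//; lra.
rewrite mul1r (Gauss_dvdp _ cop); apply/andP; split;
  apply: (dvdp_exp_iter_dstep (k := 1)) => j.
  by rewrite addn1 -mulrA dvdp_mulIl.
by rewrite addn1 mulrAC dvdp_mulIr.
Qed.

Lemma op6E a b p : op6 a b p = ('X^2 - 1) *
  (('X - 1%:P) ^+ b.+1 * ('X + 1%:P) ^+ a.+1 *
   (('X - 1%:P) ^+ a.+1 * ('X + 1%:P) ^+ b.+1 * p)^`((a + b).+3))^`((a + b).+3).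
Proof.
rewrite -[LHS]mul1r; apply: diffopp_rcoef => [||i]; last exact: dvd1p.
  exact: monic_XsubC_XaddC.
by rewrite size_XsubC_XaddC addSn addnS.
Qed.

Lemma op2_horner1 a b p : (op2 a b p).[1] = 2 * a.+1%:R * p^`().[1].
Proof.
rewrite op2E hornerD !hornerM !hornerD hornerZ hornerN !hornerX !hornerC
  hornerXn.
by rewrite -natr1; ring.
Qed.

Lemma op2_hornerN1 a b p : (op2 a b p).[- 1] = - (2 * b.+1%:R * p^`().[- 1]).
Proof.
rewrite op2E hornerD !hornerM !hornerD hornerZ hornerN !hornerX !hornerC
  hornerXn.
by rewrite -natr1; ring.
Qed.

Lemma ffact_natr n m : (m <= n)%N -> (n ^_ m)%:R = n`!%:R / (n - m)`!%:R :> R.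
Proof. by move=> mn; rewrite -(ffact_fact mn) natrM mulfK ?fact_neq0. Qed.

(** In factorials, [kb alpha beta] is b_{beta,alpha} and [kc alpha beta] is c_{alpha,beta}. *)
Definition kb a b : R := b.+2`!%:R * (a + b).+1`!%:R / a`!%:R.
Definition kc a b : R :=
  a.+1%:R * b.+1%:R * (a + b).+3%:R * (a + b).+1`!%:R ^+ 2.

(** [pair4] and [pair6] are the symmetric integrals left after all integrations by parts, with the
    normalisation of [jform] and the sign (-1)^K. *)
Definition pair4 c a b p g := jweight R a b * (- c) ^+ a * c ^+ b.+1 *
  (-1) ^+ b.+2 * integ (- c) c (('X - c%:P) ^+ (a + b).+2 *
    (('X + c%:P) ^+ b.+1 * p)^`(b.+2) * (('X + c%:P) ^+ b.+1 * g)^`(b.+2)).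

Definition pair6 a b p g := jweight R a b * (- 1) ^+ a * (-1) ^+ (a + b).+3 *
  integ (- 1) 1 (('X - 1%:P) ^+ b.+1 * ('X + 1%:P) ^+ a.+1 *
    (('X - 1%:P) ^+ a.+1 * ('X + 1%:P) ^+ b.+1 * p)^`((a + b).+3) *
    (('X - 1%:P) ^+ a.+1 * ('X + 1%:P) ^+ b.+1 * g)^`((a + b).+3)).

(** The common factor of the value of [op4] at [c] and of the boundary term of [op6] there, which
    cancel in [kform_opL]. *)
Definition edge c a b p : R :=
  2 * (a + b).+2%:R / b.+2`!%:R * ((('X + c%:P) ^+ b.+1 * p)^`(b.+2)).[c].

Lemma jform_op2 a b p g : jform 1 a b (op2 a b p * g) = jform 1 a b (op2 a b g
  * p).
Proof.
have E (f h : {poly R}) : integ (- 1) 1 (('X - 1%:P) ^+ a * ('X + 1%:P) ^+ b *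
  (op2 a b f * h)) =
  - integ (- 1) 1 (('X - 1%:P) ^+ a.+1 * ('X + 1%:P) ^+ b.+1 * (f^`() * h^`())).
  rewrite mulrA op2K mulrC integ_byparts !hornerM !horner_exp !hornerXsubC.
  rewrite !hornerD !hornerX !hornerC subrr addNr !expr0n /= !(mul0r, mulr0).
  by rewrite subrr sub0r mulrC mulrA.
by rewrite /jform !E [_^`() * _]mulrC.
Qed.

Section Point.
Variable c : R.
Hypothesis c2 : c ^+ 2 = 1.

Lemma op4_hornerN a b p : (op4 c a b p).[- c] = 0.
Proof.
have := congr1 (horner^~ (- c)) (op4K c a b p).
rewrite !hornerM hornerD hornerX hornerC addNr mul0r horner_exp hornerXsubC.
move/eqP; rewrite mulf_eq0 => /orP[|/eqP//].
by rewrite expf_eq0 -opprD oppr_eq0 -mulr2n mulrn_eq0 (negbTE (sqr1_neq0 c2))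
  andbF.
Qed.

(** The denominator [(X - c)^a] has to be divided out before evaluating at [c]; the [a]-th
    derivative there extracts the cofactor [G]. *)
Lemma op4_horner a b p : (op4 c a b p).[c] = kb a b * c * edge c a b p.
Proof.
set F := (('X + c%:P) ^+ b.+1 * p)^`(b.+2).
have /dvdpP[G HG] : ('X - c%:P) ^+ a %| (('X - c%:P) ^+ (a + b).+2 * F)^`(b.+2).
  by apply: dvdp_exp_derivn; rewrite !addnS dvdp_mulIl.
have Gc : G.[c] = (a + b).+2`!%:R / a`!%:R * F.[c].
  have := congr1 (fun q : {poly R} => q^`(a).[c]) HG.
  rewrite /= [G * _]mulrC [RHS]horner_derivn_XsubC_exp subnn ffactnn derivn0.
  rewrite -[_^`(a)](iterD a b.+2) -/(derivn _ _) horner_derivn_XsubC_exp !addnS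
    subnn ffactnn derivn0.
  rewrite -[G.[c] *+ _]mulr_natr -[F.[c] *+ _]mulr_natr => E.
  by rewrite mulrAC [_ * F.[c]]mulrC E mulfK ?fact_neq0.
have -> : op4 c a b p = ('X + c%:P) * G.
  have : ('X - c%:P) ^+ a != 0 by rewrite monic_neq0 ?monic_exp ?monicXsubC.
  by move/mulfI; apply; rewrite op4K -/F HG; ring.
rewrite hornerM hornerD hornerX hornerC Gc /edge -/F /kb [(a + b).+2`!]factS
  natrM.
by field; rewrite !fact_neq0.
Qed.

(** At [c] the power of [X - c] kills all boundary terms; at [-c] the factor [(X + c)^(b+1)] leaves
    only the last one, computed by [bdryE]. *)
Lemma jform_op4 a b p g : jform c a b (op4 c a b p * g) =
  2 * c * kb a b * b.+1%:R * p^`().[- c] * g.[- c] + pair4 c a b p g.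
Proof.
rewrite /jform /pair4.
set u := 'X - c%:P; set v := 'X + c%:P; set F := (v ^+ b.+1 * p)^`(b.+2).
have -> : u ^+ a * v ^+ b * (op4 c a b p * g) =
    v ^+ b.+1 * g * (u ^+ (a + b).+2 * F)^`(b.+2).
  by rewrite mulrACA op4K -/u -/v -/F [v ^+ b.+1]exprS; ring.
have vE : v = 'X - (- c)%:P by rewrite polyCN opprK.
rewrite integ_byparts_iter bdry_eq0; last by lia.
have := bdryE b.+1 0 g (u ^+ (a + b).+2 * F) (- c).
rewrite expr0 mul1r addn0 -vE => ->.
have Fc : F.[- c] = b.+2`!%:R * p^`().[- c].
  rewrite /F vE horner_derivn_XsubC_exp subSn// subnn -mulr_natl derivn1.
  by rewrite ffact_natr// subSn// subnn divr1.
rewrite hornerM horner_exp hornerXsubC Fc [X in integ _ _ X]mulrC.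
have sg : (- c) ^+ a * c ^+ b.+1 * (-1) ^+ b.+1 * (- c - c) ^+ (a + b).+2 =
    - (c * (2 ^+ (a + b).+1 * 2)).
  have -> : 2 ^+ (a + b).+1 * 2 = 2 ^+ a * 2 ^+ b * 4 :> R.
    by rewrite exprS exprD; ring.
  have -> : - c - c = (-1) * (c * 2) by ring.
  rewrite -[(a + b).+2]addn2 !exprMn !exprD c2 [(- c) ^+ a]exprNn.
  rewrite [c ^+ b.+1]exprS [(-1) ^+ b.+1]exprS.
  rewrite [LHS](_ : _ = - ((-1) ^+ a * (-1) ^+ a * (c ^+ a * c ^+ a) *
    (c ^+ b * c ^+ b) * ((-1) ^+ b * (-1) ^+ b) * (c * (2 ^+ a * 2 ^+ b *
      4)))); last by ring.
  by rewrite !signrr !sqr1_expr//; ring.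
rewrite mulrDr mulrA; congr (_ + _); last by rewrite !mulrA.
rewrite sub0r.
transitivity (- (jweight R a b * ((- c) ^+ a * c ^+ b.+1 * (-1) ^+ b.+1 *
   (- c - c) ^+ (a + b).+2) * ((b.+1)`! * 0`!)%:R * b.+2`!%:R * g.[- c] *
     p^`().[- c])).
  by ring.
rewrite {}sg /jweight /kb fact0 muln1 [b.+1`!]factS natrM.
have w0 : 2 ^+ (a + b).+1 != 0 :> R by rewrite expf_neq0 ?pnatr_eq0.
move: (fact_neq0 R a) (fact_neq0 R b) w0; move: (a`!%:R) (b`!%:R) (b.+2`!%:R)
  ((a + b).+1`!%:R) (2 ^+ (a + b).+1).
by move=> *; field; do !(apply/andP; split).
Qed.

End Point.

(** The orders [a + 1] and [b + 1] of the zeros at [c] add up to one less than the number of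
    derivatives, as in [bdryE]. The other end point is the case of [-c] with [a] and [b]
    exchanged. *)
Lemma bdry6 c a b p g :
  bdry (a + b).+3 (('X - c%:P) ^+ a.+1 * ('X + c%:P) ^+ b.+1 * g)
    (('X - c%:P) ^+ b.+1 * ('X + c%:P) ^+ a.+1 *
      (('X - c%:P) ^+ a.+1 * ('X + c%:P) ^+ b.+1 * p)^`((a + b).+3)) c =
  (-1) ^+ a.+1 * (a.+1`!%:R * b.+1`!%:R) * (2 * c) ^+ (a + b).+2 *
  ((a + b).+3`!%:R / b.+2`!%:R) *
  ((('X + c%:P) ^+ b.+1 * p)^`(b.+2)).[c] * g.[c].
Proof.
set u := 'X - c%:P; set v := 'X + c%:P.
have vc : v.[c] = 2 * c by rewrite /v hornerD hornerX hornerC; ring.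
have -> : (a + b).+3 = (a.+1 + b.+1).+1 by rewrite addSn addnS.
rewrite -[X in bdry _ X]mulrA -[X in bdry _ _ X]mulrA bdryE !hornerM
  !horner_exp vc.
rewrite -[u ^+ a.+1 * _ * p]mulrA horner_derivn_XsubC_exp.
have -> : ((a.+1 + b.+1).+1 - a.+1 = b.+2)%N by lia.
rewrite -[_.[c] *+ _]mulr_natr ffact_natr; last by lia.
have -> : ((a.+1 + b.+1).+1 - a.+1 = b.+2)%N by lia.
have -> : ((a + b).+2 = a.+1 + b.+1)%N by rewrite addSn addnS.
by rewrite natrM exprD; ring.
Qed.

Lemma jform_op6 a b p g : jform 1 a b (op6 a b p * g) =
  kc a b * (edge (-1) b a p * g.[- 1] - edge 1 a b p * g.[1]) + pair6 a b p g.
Proof.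
rewrite /jform /pair6 op6E expr1n mulr1.
set u := 'X - 1%:P; set v := 'X + 1%:P.
set W := (u ^+ a.+1 * v ^+ b.+1 * p)^`(_).
have -> : u ^+ a * v ^+ b * (('X^2 - 1) * (u ^+ b.+1 * v ^+ a.+1 * W)^`((a +
  b).+3) * g) =
    u ^+ a.+1 * v ^+ b.+1 * g * (u ^+ b.+1 * v ^+ a.+1 * W)^`((a + b).+3).
  have -> : 'X^2 - 1 = u * v :> {poly R} by rewrite /u /v polyC1; ring.
  by rewrite [u ^+ a.+1]exprS [v ^+ b.+1]exprS; ring.
rewrite integ_byparts_iter.
have -> := bdry6 1 a b p g.
have := bdry6 (-1) b a p g.
rewrite polyCN opprK -/u -/v [(b + a)%N]addnC [v ^+ b.+1 * u ^+ _]mulrC.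
rewrite [v ^+ a.+1 * u ^+ _]mulrC -/W => ->.
rewrite [X in integ _ _ X]mulrC mulrDr mulrA; congr (_ + _); last by rewrite
  !mulrA.
rewrite /edge polyCN -/u -/v [(b + a)%N]addnC mulr1 mulrN1.
move: (_.[1]) (_.[1]) (_.[-1]) (_.[-1]) => F1 g1 FN gN.
rewrite /jweight /kc [(a + b).+3`!%:R]natr_factS [(a + b).+2`!%:R]natr_factS.
rewrite [a.+1`!%:R]natr_factS [b.+1`!%:R]natr_factS.
rewrite [(- 2) ^+ _]exprNn [2 ^+ (a + b).+2]exprS.
have -> : (-1) ^+ (a + b).+2 = (-1) ^+ a * (-1) ^+ b :> R.
  by rewrite 2!exprS exprD; ring.
rewrite [(-1) ^+ a.+1]exprS [(-1) ^+ b.+1]exprS.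
have w0 : 2 ^+ (a + b).+1 != 0 :> R by rewrite expf_neq0 ?pnatr_eq0.
move: (fact_neq0 R a) (fact_neq0 R b) (fact_neq0 R a.+2) (fact_neq0 R b.+2) w0.
move: (a`!%:R) (b`!%:R) (a.+2`!%:R) (b.+2`!%:R) ((a + b).+1`!%:R)
  (2 ^+ (a + b).+1) (a.+1%:R) (b.+1%:R) ((a + b).+2%:R) ((a + b).+3%:R).
move=> A B A2 B2 AB w a1 b1 ab2 ab3 A0 B0 A20 B20 W0.
rewrite -signr_odd -[(-1) ^+ b]signr_odd.
by case: (odd a); case: (odd b); rewrite ?expr0 ?expr1; field;
  do !(apply/andP; split).
Qed.

Lemma size_coef2 a b i : (1 <= i <= 2)%N -> size (coef2 a b i) = i.+1.
Proof.
move=> i2; have sV := size_XsubC_XaddC 1 a.+1 b.+1.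
have abe : (0 + (a.+1 + b.+1) = (a + b) + 2)%N by lia.
apply: (size_rcoef (monic1 _) (monic_XsubC_XaddC 1 a b) (monic1 _)
  (monic_XsubC_XaddC 1 a.+1 b.+1) (size_poly1 R) (size_XsubC_XaddC 1 a b)
  (size_poly1 R) sV abe); lia.
Qed.

Lemma size_coef4 c a b i : (1 <= i <= 2 * b.+2)%N -> size (coef4 c a b i) =
  i.+1.
Proof.
move=> ib.
have mu m : ('X - c%:P) ^+ m \is monic by rewrite monic_exp ?monicXsubC.
have mv m : ('X + c%:P) ^+ m \is monic by rewrite monic_exp ?monicXaddC.
have abe : (1 + (a + b).+2 = a + b.+3)%N by lia.
apply: (size_rcoef (monicXaddC _) (mu _) (mv _) (mu _) (size_XaddC c)
  (size_exp_XsubC a c) (size_exp_XaddC b.+1 c) (size_exp_XsubC _ c) abe) => //;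
    lia.
Qed.

Lemma coef4_top c a b : c ^+ 2 = 1 ->
  coef4 c a b (2 * b.+2)%N = ('X^2 - 1) ^+ b.+2.
Proof.
move=> c2; have u0 : ('X - c%:P) ^+ a != 0 by rewrite monic_neq0 ?monic_exp
  ?monicXsubC.
apply: (mulfI u0); rewrite (rcoef_top (dvdp_coef4 c a b)).
have -> : 'X^2 - 1 = ('X - c%:P) * ('X + c%:P) :> {poly R}.
  by rewrite -subr_sqr -rmorphXn /= c2.
have -> : ((a + b).+2 = a + b.+2)%N by lia.
by rewrite exprD exprMn [('X + c%:P) ^+ b.+2]exprS; ring.
Qed.

Lemma size_coef6 a b i : (2 <= i <= 2 * (a + b).+3)%N ->
  size (coef6 a b i) = i.+1.
Proof.
move=> iab; have sU := size_XsubC_XaddC 1 a.+1 b.+1; rewrite addSn addnS in sU.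
have sV := size_XsubC_XaddC 1 b.+1 a.+1; rewrite addSn addnS [(b + a)%N]addnC
  in sV.
have abe : (2 + (a + b).+2 = 0 + (a + b).+4)%N by lia.
apply: (size_rcoef (monicXnsubC _ (ltn0Sn 1)) (monic1 _) (monic_XsubC_XaddC _ _
  _)
  (monic_XsubC_XaddC _ _ _) (size_XnsubC _ (ltn0Sn 1)) (size_poly1 R) sU sV
    abe); lia.
Qed.

Lemma size_coef6_le a b i : (size (coef6 a b i) <= i.+1)%N.
Proof.
have sU := size_XsubC_XaddC 1 a.+1 b.+1; rewrite addSn addnS in sU.
have sV := size_XsubC_XaddC 1 b.+1 a.+1; rewrite addSn addnS [(b + a)%N]addnC
  in sV.
have abe : (2 + (a + b).+2 = 0 + (a + b).+4)%N by lia.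
exact: (size_rcoef_le (monicXnsubC _ (ltn0Sn 1)) (monic1 _) (monic_XsubC_XaddC
  _ _ _)
  (monic_XsubC_XaddC _ _ _) (size_XnsubC _ (ltn0Sn 1)) (size_poly1 R) sU sV
    abe).
Qed.

Lemma coef6_top a b : coef6 a b (2 * (a + b).+3)%N = ('X^2 - 1) ^+ (a + b).+3.
Proof.
rewrite -[LHS]mul1r rcoef_top => [|i]; last exact: dvd1p.
have -> : 'X^2 - 1 = ('X - 1%:P) * ('X + 1%:P) :> {poly R} by rewrite polyC1;
  ring.
have -> : ((a + b).+3 = a.+1 + b.+1 + 1)%N by lia.
by rewrite exprMn !exprD; ring.
Qed.

End Operators.

(** * Symmetry of the combined operator *)

Section Eigen.
Variable R : rcfType.
Implicit Types (c M N : R) (f g p q : {poly R}) (n a b : nat).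

Definition opL M N a b p := op2 a b p + (M / kb R a b) *: op4 1 a b p
  + (N / kb R b a) *: op4 (-1) b a p + (M * N / kc R a b) *: op6 a b p.

Lemma kb_neq0 a b : kb R a b != 0.
Proof. by rewrite /kb !mulf_neq0 ?invr_eq0 ?fact_neq0. Qed.

Lemma kc_neq0 a b : kc R a b != 0.
Proof. by rewrite /kc !mulf_neq0 ?expf_neq0 ?fact_neq0// pnatr_eq0. Qed.

Lemma pair4C c a b p g : pair4 c a b p g = pair4 c a b g p.
Proof. by rewrite /pair4; move: (_^`(_)) (_^`(_)) => f h; rewrite [X in integ _
  _ X]mulrAC. Qed.

Lemma pair6C a b p g : pair6 a b p g = pair6 a b g p.
Proof. by rewrite /pair6; move: (_^`(_)) (_^`(_)) => f h; rewrite [X in integ _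
  _ X]mulrAC. Qed.

Lemma op6_horner a b p z : z ^+ 2 = 1 -> (op6 a b p).[z] = 0.
Proof.
move=> z2; rewrite op6E hornerM hornerD hornerN hornerXn z2 -polyC1 hornerC.
by rewrite subrr mul0r.
Qed.

(** The point masses applied to [op2] cancel the boundary terms of the two [op4], and applied to
    each [op4] at its own point [c] they cancel those of [op6]; [op6] itself vanishes at both ends.
    What remains is symmetric in [p] and [g]. *)
Lemma kform_opL M N a b p g : kform M N a b (opL M N a b p) g =
  jform 1 a b (op2 a b p * g) + M / kb R a b * pair4 1 a b p g
  + N / kb R b a * pair4 (-1) b a p g + M * N / kc R a b * pair6 a b p g.
Proof.
have h1 : (1 : R) ^+ 2 = 1 by rewrite expr1n.
have j4 := jform_op4 h1 a b p g.
have j4' := jform_op4 (sqrN1 R) b a p g; rewrite jformN opprK in j4'.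
have j6 := jform_op6 a b p g.
have e1 := op2_horner1 a b p; have eN := op2_hornerN1 a b p.
have f1 := op4_horner 1 a b p; have f1N := op4_hornerN h1 a b p.
have g1 := op4_horner (-1) b a p; have g1N := op4_hornerN (sqrN1 R) b a p.
rewrite opprK in g1N.
have s1 := op6_horner a b p h1; have sN := op6_horner a b p (sqrN1 R).
rewrite /kform /opL.
move: j4 j4' j6 e1 eN f1 f1N g1 g1N s1 sN.
move: (kb_neq0 a b) (kb_neq0 b a) (kc_neq0 a b) => k1 k2 k3.
move: (pair4 1 a b p g) (pair4 (-1) b a p g) (pair6 a b p g) => P Q S.
move: (edge 1 a b p) (edge (-1) b a p) => E1 E2.
move: (op2 a b p) (op4 1 a b p) (op4 (-1) b a p) (op6 a b p) => f2 f4 f4' f6.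
move=> j4 j4' j6 e1 eN fc f1N gc g1N s1 sN.
rewrite !mulrDl -![(_ *: _) * g]scalerAl !jformD !jformZ j4 j4' j6.
rewrite !hornerD !hornerZ !hornerM e1 eN fc f1N gc g1N s1 sN.
move: (jform _ _ _ _) k1 k2 k3; move: (kb R a b) (kb R b a) (kc R a b) => *.
by field; do !(apply/andP; split).
Qed.

Lemma kform_opLC M N a b p g :
  kform M N a b (opL M N a b p) g = kform M N a b p (opL M N a b g).
Proof.
have -> : kform M N a b p (opL M N a b g) = kform M N a b (opL M N a b g) p.
  by rewrite /kform mulrC.
by rewrite !kform_opL jform_op2 !(pair4C _ _ _ p) (pair6C _ _ p).
Qed.

(** The eigenvalues in the shape produced by [coef_diffopp]; they are identified with the [Lambda]
    constants afterwards. *)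
Definition eigen2 a b n : R := ((n + 0) ^_ 1)%:R * ((n.-1 + (a + b).+2) ^_
  1)%:R.
Definition eigen4 a b n : R :=
  ((n + b.+1) ^_ b.+2)%:R * ((n.-1 + (a + b).+2) ^_ b.+2)%:R.
Definition eigen6 a b n : R :=
  ((n + (a + b).+2) ^_ (a + b).+3)%:R * ((n.-1 + (a + b).+2) ^_ (a + b).+3)%:R.

Lemma op2_top a b n p : (size p <= n.+1)%N ->
  (size (op2 a b p) <= n.+1)%N /\ (op2 a b p)`_n = p`_n * eigen2 a b n.
Proof.
move=> ps; rewrite /eigen2 mulrA /op2 -[2%N]/(2 * 1)%N.
have s1 := size_poly1 R.
have sV := size_XsubC_XaddC (1 : R) a.+1 b.+1; rewrite addSn addnS in sV.
have m := @monic_XsubC_XaddC R 1; have d := dvdp_coef2 R a b.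
have abe : (0 + (a + b).+2 = (a + b) + 2)%N by rewrite addn2.
have sD := size_XsubC_XaddC (1 : R) a b.
split.
  exact: (size_diffopp (monic1 _) (m a b) (monic1 _) (m _ _) s1 sD s1 sV abe
    ps).
exact: (coef_diffopp (monic1 _) (m a b) (monic1 _) (m _ _) s1 sD s1 sV abe d
  ps).
Qed.

Lemma op4_top c a b n p : (size p <= n.+1)%N ->
  (size (op4 c a b p) <= n.+1)%N /\ (op4 c a b p)`_n = p`_n * eigen4 a b n.
Proof.
move=> ps; rewrite /eigen4 mulrA; have d := dvdp_coef4 c a b.
have mu m : ('X - c%:P) ^+ m \is monic by rewrite monic_exp ?monicXsubC.
have mv m : ('X + c%:P) ^+ m \is monic by rewrite monic_exp ?monicXaddC.
have su m := size_exp_XsubC m c; have sv m := size_exp_XaddC m c.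
have abe : (1 + (a + b).+2 = a + b.+3)%N by lia.
have sp := size_XaddC c.
split.
  exact: (size_diffopp (monicXaddC _) (mu _) (mv _) (mu _) sp (su _) (sv _) (su
    _) abe ps).
exact: (coef_diffopp (monicXaddC _) (mu _) (mv _) (mu _) sp (su _) (sv _) (su
  _) abe d ps).
Qed.

Lemma op6_top a b n p : (size p <= n.+1)%N ->
  (size (op6 a b p) <= n.+1)%N /\ (op6 a b p)`_n = p`_n * eigen6 a b n.
Proof.
move=> ps; rewrite /eigen6 mulrA.
have m := @monic_XsubC_XaddC R 1.
have sU := size_XsubC_XaddC (1 : R) a.+1 b.+1; rewrite addSn addnS in sU.
have sV := size_XsubC_XaddC (1 : R) b.+1 a.+1; rewrite addSn addnS [(b +
  a)%N]addnC in sV.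
have abe : (2 + (a + b).+2 = 0 + (a + b).+4)%N by lia.
have mp : ('X^2 - 1 : {poly R}) \is monic by apply: monicXnsubC.
have sp : size ('X^2 - 1 : {poly R}) = 3 by apply: size_XnsubC.
have d i : (1 : {poly R}) %| ('X^2 - 1) * jop (a + b).+3
   (('X - 1%:P) ^+ a.+1 * ('X + 1%:P) ^+ b.+1)
   (('X - 1%:P) ^+ b.+1 * ('X + 1%:P) ^+ a.+1) i by rewrite dvd1p.
split.
  exact: (size_diffopp mp (monic1 _) (m _ _) (m _ _) sp (size_poly1 R) sU sV
    abe ps).
exact: (coef_diffopp mp (monic1 _) (m _ _) (m _ _) sp (size_poly1 R) sU sV abe
  d ps).
Qed.

Definition eigenL M N a b n := eigen2 a b n + M / kb R a b * eigen4 a b n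
  + N / kb R b a * eigen4 b a n + M * N / kc R a b * eigen6 a b n.

(** With the sign moved inside, the weight is (1-x)^a (1+x)^b, nonnegative on the interval. *)
Lemma jform_sqrE a b f : jform 1 a b (f * f) = jweight R a b *
  integ (- 1) 1 ((-1) ^+ a *: (('X - 1%:P) ^+ a * ('X + 1%:P) ^+ b * (f * f))).
Proof. by rewrite /jform integZ expr1n mulr1 mulrA. Qed.

Lemma sqr_weight_ge0 a b f z : -1 < z < 1 ->
  0 <= ((-1) ^+ a *: (('X - 1%:P) ^+ a * ('X + 1%:P) ^+ b * (f * f))).[z].
Proof.
move=> /andP[z1 z2]; rewrite hornerZ !hornerM !horner_exp hornerXsubC hornerD.
rewrite hornerX hornerC.
rewrite [leRHS](_ : _ = (1 - z) ^+ a * (z + 1) ^+ b * f.[z] ^+ 2); last first.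
  by rewrite -(opprB z 1) [(- (z - 1)) ^+ a]exprNn; ring.
by apply: mulr_ge0 (sqr_ge0 _); apply: mulr_ge0; apply: exprn_ge0; lra.
Qed.

Lemma jweight_gt0 a b : 0 < jweight R a b.
Proof.
by rewrite /jweight divr_gt0 ?mulr_gt0 ?exprn_gt0 ?ltr0n ?fact_gt0.
Qed.

Lemma jform_sqr_ge0 a b f : 0 <= jform 1 a b (f * f).
Proof.
rewrite jform_sqrE mulr_ge0 ?(ltW (jweight_gt0 _ _))//.
have N11 : -1 < 1 :> R by lra.
apply: integ_ge0 N11 _ => z; exact: sqr_weight_ge0.
Qed.

Lemma jform_sqr_eq0 a b f : jform 1 a b (f * f) = 0 -> f = 0.
Proof.
rewrite jform_sqrE => /eqP; rewrite mulf_eq0 gt_eqF ?jweight_gt0//= => /eqP.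
move/integ_ge0_eq0; have -> : -1 < 1 :> R by lra.
move=> /(_ isT (@sqr_weight_ge0 a b f))/eqP.
rewrite scaler_eq0 signr_eq0/= !mulf_eq0 orbb => /orP[|/eqP//].
rewrite -mulf_eq0 => /eqP h; have := monic_neq0 (monic_XsubC_XaddC (1 : R) a b).
by rewrite h eqxx.
Qed.

Lemma size_opL M N n a b p : (size p <= n)%N ->
  (size (opL M N a b p) <= n)%N.
Proof.
case: n => [|n] ps; last first.
  have [s2 _] := op2_top a b ps; have [s4 _] := op4_top 1 a b ps.
  have [s4' _] := op4_top (-1) b a ps; have [s6 _] := op6_top a b ps.
  have auz k f : (size f <= n.+1)%N -> (size (k *: f) <= n.+1)%N.
    exact: leq_trans (size_scale_leq _ _).
  by rewrite /opL !size_polyD_le ?auz.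
have -> : opL M N a b p = 0; last by rewrite size_poly0.
move: ps; rewrite size_poly_leq0 => /eqP ->.
have d0 m (h : nat -> {poly R}) : diffopp m h (0 : {poly R}) = 0.
  by apply: big1 => i _; rewrite linear0 mulr0.
by rewrite /opL /op2 /op4 /op6 !d0 !scaler0 !addr0.
Qed.

Lemma size_opL_eigenL M N n a b p : (size p <= n.+1)%N ->
  (size (opL M N a b p - eigenL M N a b n *: p)%R <= n)%N.
Proof.
move=> ps; rewrite /opL /eigenL.
have [s2 t2] := op2_top a b ps; have [s4 t4] := op4_top 1 a b ps.
have [s4' t4'] := op4_top (-1) b a ps; have [s6 t6] := op6_top a b ps.
move: s2 t2 s4 t4 s4' t4' s6 t6.
move: (op2 a b p) (op4 1 a b p) (op4 (-1) b a p) (op6 a b p) => f2 f4 f4' f6.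
move=> s2 t2 s4 t4 s4' t4' s6 t6; set F := (X in size X).
have Fn : F`_n = 0.
  by rewrite /F !(coefD, coefN, coefZ) t2 t4 t4' t6; ring.
have auz k f : (size f <= n.+1)%N -> (size (k *: f) <= n.+1)%N.
  exact: leq_trans (size_scale_leq _ _).
have Fs : (size F <= n.+1)%N by rewrite /F !size_polyD_le ?size_polyN ?auz.
apply/leq_sizeP => j; rewrite leq_eqVlt => /predU1P[<-//|].
by move: j; apply/leq_sizeP.
Qed.

Lemma opL_koornp M N n a b : 0 <= M -> 0 <= N ->
  opL M N a b (koornp M N n a b) = eigenL M N a b n *: koornp M N n a b.
Proof.
move=> M0 N0; have ys := size_koornp M N n a b.
have Fs := size_opL_eigenL M N a b ys; move: Fs.
set F := (_ - _) => Fs; apply/eqP; rewrite -subr_eq0 -/F; apply/eqP.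
have FF : kform M N a b F F = 0.
  rewrite {1}/F.
  have -> (f h g : {poly R}) k : kform M N a b (f - k *: h) g =
      kform M N a b f g - k * kform M N a b h g.
    by rewrite /kform mulrBl -scalerAl jformD -scaleNr jformZ !hornerD
      !hornerZ; ring.
  (* By symmetry the operator passes to [F], whose size bound [n] it preserves; both terms then
     vanish by orthogonality. *)
  rewrite kform_opLC !koornp_orthogonal ?mulr0 ?subrr//.
  exact: size_opL.
have J0 := jform_sqr_ge0 a b F.
(* The point masses contribute nonnegative squares, so the integral part alone is already 0. *)
apply: (@jform_sqr_eq0 a b); apply/eqP; rewrite eq_le J0 andbT -FF /kform.
by rewrite !hornerM -!expr2 -addrA lerDl addr_ge0// mulr_ge0// sqr_ge0.
Qed.

End Eigen.

(** * Comparison with the hypergeometric definitions *)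

Section Bridge.
Variable R : realType.
Implicit Types (x M N : R) (a b m n k : nat).

Lemma poch_natr m k : poch m%:R k = ((m + k).-1 ^_ k)%:R :> R.
Proof.
rewrite /poch; elim: k => [|k IH]; first by rewrite big_ord0.
rewrite big_ord_recr /= IH -natrD -natrM; congr (_%:R).
(* The predecessor is truncated only for [m = k = 0], where the new factor is 0. *)
case: (posnP (m + k)) => [/eqP|mk].
  by rewrite addn_eq0 => /andP[/eqP-> /eqP->].
by rewrite addnS /= -[in RHS](prednK mk) ffactSS mulnC prednK.
Qed.

Lemma poch_natrS m k : poch m.+1%:R k = (m + k)`!%:R / m`!%:R :> R.
Proof. by rewrite poch_natr addSn /= ffact_natr ?leq_addl// addnK. Qed.

Lemma bconstE a b : bconst R b a = kb R a b.
Proof.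
by rewrite /bconst /kb natr1 poch_natrS addn2 addnS mulrA.
Qed.

Lemma cconstE a b : cconst R a b = kc R a b.
Proof.
rewrite /cconst /kc addn1 !natr1; congr (_ * _ * _).
by rewrite -natrD -natrD addn3.
Qed.

Lemma Lambda2E a b n : Lambda2 R a b n = eigen2 R a b n.
Proof.
rewrite /Lambda2 /eigen2 addn0 !ffactn1; case: n => [|n]; first by rewrite
  !mul0r.
congr (_ * _); rewrite /= -!natrD natr1; congr (_%:R); lia.
Qed.

Lemma Lambda4E a b n : Lambda4 R b a n = eigen4 R a b n.
Proof.
rewrite /Lambda4 /eigen4 -natrD !poch_natr addn2.
case: n => [|n]; last by congr (_%:R * _%:R); congr (_ ^_ _); lia.
by rewrite [in LHS]ffact_small// [X in _ = X%:R * _]ffact_small// !mul0r.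
Qed.

Lemma Lambda6E a b n : Lambda6 R a b n = eigen6 R a b n.
Proof.
rewrite /Lambda6 /eigen6 addn3 mulrC poch_natr.
(* For [n = 0] the argument [n - 1] is negative, but the other Pochhammer factor is 0. *)
case: n => [|n].
  by rewrite [in LHS]ffact_small// [X in _ = X%:R * _]ffact_small// !mul0r.
rewrite -natr1 addrK poch_natr.
by congr (_%:R * _%:R); congr (_ ^_ _); lia.
Qed.

Lemma koorn_qE m a b : koorn_q m.+1 (a%:R : R) b%:R = kq R m a b.
Proof.
rewrite /koorn_q /kq /=.
have -> : a%:R + b%:R + 2 = (a + b).+2%:R :> R by rewrite -!natrD addn2.
have -> : b%:R + 2 = b.+2%:R :> R by rewrite -natrD addn2.
rewrite natr1 !poch_natrS.
have -> : ((a + b).+1 + m.+1 = (a + b + m).+2)%N by lia.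
rewrite addSn.
move: (fact_neq0 R a) (fact_neq0 R b.+1) (fact_neq0 R (a + b).+1)
  (fact_neq0 R (a + m)) (fact_neq0 R m.+1).
move: (a`!%:R) (b.+1`!%:R) ((a + b).+1`!%:R) ((a + m)`!%:R) (m.+1`!%:R)
  ((a + b + m).+2`!%:R) ((b + m).+1`!%:R) => *.
by field; do !(apply/andP; split).
Qed.

Lemma koorn_rE m a b : koorn_r m.+1 (a%:R : R) b%:R = kq R m b a.
Proof. by rewrite -koorn_qE /koorn_r /koorn_q [a%:R + _]addrC. Qed.

Lemma koorn_sE m a b : koorn_s m.+2 (a%:R : R) b%:R = ks R m a b.
Proof.
rewrite /koorn_s /ks /=.
have -> : a%:R + b%:R + 2 = (a + b).+2%:R :> R by rewrite -!natrD addn2.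
rewrite !natr1 !poch_natrS.
have -> : ((a + b).+1 + m.+2 = (a + b + m).+3)%N by lia.
have -> : ((a + b).+1 + m.+3 = (a + b + m).+4)%N by lia.
have a0 : a.+1%:R != 0 :> R by rewrite pnatr_eq0.
have b0 : b.+1%:R != 0 :> R by rewrite pnatr_eq0.
move: (fact_neq0 R m.+1) (fact_neq0 R (a + b).+1) (fact_neq0 R m.+2) a0 b0.
move: (m.+1`!%:R) ((a + b).+1`!%:R) (m.+2`!%:R) (a.+1%:R) (b.+1%:R)
  ((a + b + m).+3`!%:R) ((a + b + m).+4`!%:R) => *.
by field; do !(apply/andP; split).
Qed.

Lemma poch_opp_natr n k : poch (- n%:R) k = (-1) ^+ k * (n ^_ k)%:R :> R.
Proof.
rewrite /poch; elim: k => [|k IH]; first by rewrite big_ord0 mul1r.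
rewrite big_ord_recr /= IH ffactnSr natrM exprS.
have [kn|nk] := leqP k n; first by rewrite natrB//; ring.
by rewrite ffact_small// !mul0r !mulr0 mul0r.
Qed.

(** The factor (-n)_k vanishes for k > n, so the partial sums are eventually constant. *)
Lemma hyp2F1_terminating n (B C z : R) : hyp2F1 (- n%:R) B C z =
  \sum_(k < n.+1) poch (- n%:R) k * poch B k / (poch C k * k`!%:R) * z ^+ k.
Proof.
rewrite /hyp2F1; set t := (X in series X).
rewrite -(big_mkord predT t); apply: (@norm_lim_near_cst R R^o) => //.
exists n.+1 => // m /= nm; rewrite /series /= (big_cat_nat (n := n.+1))//=.
rewrite [X in _ + X]big_nat [X in _ + X]big1 ?addr0// => k /andP[nk _].
by rewrite /t poch_opp_natr ffact_small// mulr0 !mul0r.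
Qed.

Lemma expr_shift_sum (t : R) n s : (s <= n)%N ->
  t ^+ s * (1 + t) ^+ (n - s) = \sum_(k < n.+1) 'C(n - s, n - k)%:R * t ^+ k.
Proof.
move=> sn; rewrite (reindex_inj rev_ord_inj) /= [1 + t]addrC exprDn mulr_sumr.
rewrite (big_ord_widen n.+1 (fun i =>
  t ^+ s * (t ^+ (n - s - i) * 1 ^+ i *+ 'C(n - s, i)))); last by rewrite ltnS
    leq_subr.
rewrite big_mkcond; apply: eq_bigr => i _ /=.
have iN : (i <= n)%N by rewrite -ltnS.
rewrite subSS subKn// ltnS; case: leqP => h; last by rewrite bin_small// mul0r.
rewrite expr1n mulr1 -[t ^+ _ *+ _]mulr_natl mulrCA -exprD.
by congr (_ * t ^+ _); lia.
Qed.

Lemma bin_mul_bin (N i j : nat) : (j <= i <= N)%N ->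
  'C(N, i)%:R * 'C(i, j)%:R = 'C(N, j)%:R * 'C(N - j, i - j)%:R :> R.
Proof.
move=> /andP[ji iN]; have [d di] : exists d, i = (j + d)%N.
  by exists (i - j)%N; rewrite subnKC.
have [e Ne] : exists e, N = (j + d + e)%N by exists (N - i)%N; rewrite -di
  subnKC.
rewrite Ne di -addnA !addKn [in 'C(_, (j + d)%N)]addnA !natr_bin.
move: (fact_neq0 R j) (fact_neq0 R d) (fact_neq0 R e) (fact_neq0 R (j + d))
  (fact_neq0 R (d + e)).
move: (j`!%:R) (d`!%:R) (e`!%:R) ((j + d)`!%:R) ((d + e)`!%:R) => *.
by rewrite addnA; field; do !(apply/andP; split).
Qed.

(** After expanding the powers of 1 + t and exchanging the sums, [bin_mul_bin] turns each
    coefficient into a Vandermonde sum. *)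
Lemma jacobip_expand a b n t : (jacobip 1 n a b : {poly R}).[1 + 2 * t] =
  \sum_(k < n.+1) ('C(n + a, n - k) * 'C(n + a + b + k, k))%:R * t ^+ k.
Proof.
rewrite /jacobip hornerZ horner_sum.
transitivity (\sum_(s < n.+1) \sum_(k < n.+1)
    ('C(n + a, n - s) * 'C(n + b, s))%:R * 'C(n - s, n - k)%:R * t ^+ k).
  rewrite mulr_sumr; apply: eq_bigr => s _.
  have sn : (s <= n)%N by rewrite -ltnS.
  rewrite hornerZ hornerM !horner_exp hornerXsubC hornerD hornerX hornerC.
  have -> : 1 + 2 * t - 1 = 2 * t by ring.
  have -> : 1 + 2 * t + 1 = 2 * (1 + t) by ring.
  rewrite !exprMn mulrCA [2 ^+ s * _ * _]mulrACA expr_shift_sum// -exprD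
    subnKC//.
  rewrite [2^-1 ^+ n * _]mulrA -exprMn mulVf ?pnatr_eq0// expr1n mul1r
    mulr_sumr.
  by apply: eq_bigr => k _; rewrite mulrA.
rewrite exchange_big; apply: eq_bigr => k _ /=; rewrite -mulr_suml; congr (_ *
  _).
have kn : (k <= n)%N by rewrite -ltnS.
have -> : (n + a + b + k = (n + b) + (a + k))%N by lia.
rewrite -(binomial.Vandermonde (n + b) (a + k) k) [in RHS]natrM natr_sum
  mulr_sumr.
rewrite (big_ord_widen n.+1 (fun s => 'C(n + a, n - k)%:R *
  ('C(n + b, s) * 'C(a + k, k - s))%:R)) ?ltnS// [in RHS]big_mkcond.
apply: eq_bigr => s _; rewrite ltnS; have sn : (s <= n)%N by rewrite -ltnS.
case: leqP => h; last by rewrite ['C(n - s, n - k)]bin_small ?mulr0//; lia.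
rewrite natrM mulrAC bin_mul_bin; last by lia.
rewrite natrM -mulrA [X in _ * X]mulrC; congr (_ * (_ * 'C(_, _)%:R)); lia.
Qed.

Lemma jacobiE n a b x : jacobi n a%:R b%:R x = (jacobip 1 n a b).[x].
Proof.
have {2}-> : x = 1 + 2 * ((x - 1) / 2) by field.
rewrite jacobip_expand /jacobi hyp2F1_terminating mulr_sumr.
apply: eq_bigr => k _; have kn : (k <= n)%N by rewrite -ltnS.
rewrite poch_opp_natr ffact_natr// natr1 -!natrD natr1 !poch_natrS.
(* This sign compensates the (-1)^k coming from (-n)_k. *)
have -> : (1 - x) / 2 = (-1) * ((x - 1) / 2) by field.
rewrite exprMn !mulrA; congr (_ * _).
have e1 : 'C(n + a, n - k)%:R = (a + n)`!%:R / ((n - k)`!%:R * (a + k)`!%:R) :>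
  R.
  have -> : (n + a = (n - k) + (a + k))%N by lia.
  by rewrite natr_bin; congr (_`!%:R / _); lia.
have e2 : 'C(n + a + b + k, k)%:R =
    (n + a + b + k)`!%:R / (k`!%:R * (n + a + b)`!%:R) :> R.
  by rewrite addnC natr_bin.
rewrite natrM e1 e2.
move: (fact_neq0 R a) (fact_neq0 R n) (fact_neq0 R k) (fact_neq0 R (n - k))
  (fact_neq0 R (a + k)) (fact_neq0 R (n + a + b)).
move: (a`!%:R) (n`!%:R) (k`!%:R) ((n - k)`!%:R) ((a + k)`!%:R)
  ((n + a + b)`!%:R) ((a + n)`!%:R) ((n + a + b + k)`!%:R) => *.
by rewrite -signr_odd; case: (odd k); rewrite ?expr0 ?expr1; field;
  do !(apply/andP; split).
Qed.

Lemma koornwinderE n a b M N x :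
  koornwinder n a%:R b%:R M N x = (koornp M N n a b).[x].
Proof.
rewrite /koornwinder /koornp !hornerD [(M *: _).[x]]hornerZ [(N *:
  _).[x]]hornerZ.
rewrite [((M * N) *: _).[x]]hornerZ jacobiE.
have d2 m : m%:R + 2 = m.+2%:R :> R by rewrite -natrD addn2.
congr (_ + _ * _ + _ * _ + _ * _).
- case: n => [|m]; first by rewrite horner0.
  rewrite /koorn_Q koorn_qE d2 jacobiE /kQ [RHS]hornerZ hornerM hornerD hornerX
    hornerC.
  by rewrite mulrA.
- case: n => [|m]; first by rewrite horner0.
  rewrite /koorn_R koorn_rE d2 jacobiE /kQ jacobipN [RHS]hornerZ hornerM
    hornerD hornerX hornerC.
  by rewrite mulrA.
- case: n => [|[|m]]; rewrite ?horner0//.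
  rewrite /koorn_S koorn_sE !d2 jacobiE /kS [RHS]hornerZ hornerM hornerD
    hornerN hornerXn.
  by rewrite -polyC1 hornerC mulrA.
Qed.

End Bridge.

(** * Expansion of the operators on smooth functions *)

Section Expansion.
Variable R : realType.
Implicit Types (p : nat -> {poly R}) (q U V : {poly R}) (f g y : R -> R) (x z :
  R).

Lemma near_eq_derive1n k f g x : (\forall z \near x, f z = g z) ->
  \forall z \near x, derive1n k f z = derive1n k g z.
Proof.
move=> fg; elim: k => [//|k IH].
have := near_join IH; apply: filterS => z Hz.
by rewrite !derive1nS !derive1E; apply: near_eq_derive.
Qed.

Definition dfun m p y z := \sum_(i < m) (p i).[z] * derive1n i y z.

Lemma is_derive_dfun m p y z : (forall i, (m <= i)%N -> p i = 0) ->
  (forall i, (i < m)%N -> derivable (derive1n i y) z 1) ->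
  'D_1 (dfun m p y) z = dfun m.+1 (dstep p) y z.
Proof.
move=> p0 dy.
have -> : dfun m p y = \sum_(i < m) (fun t => (p i).[t] * derive1n i y t).
  by apply/funext => t; rewrite /dfun fct_sumE.
have H (i : 'I_m) : is_derive z (1 : R) (fun t => (p i).[t] * derive1n i y t)
    ((p i)^`().[z] * derive1n i y z + (p i).[z] * derive1n i.+1 y z).
  have h1 : is_derive z (1 : R) (derive1n i y) (derive1n i.+1 y z).
    by rewrite derive1nS derive1E; apply: DeriveDef => //; exact: dy.
  have := is_deriveM (is_derive_poly (p i) z) h1.
  have -> : horner (p i) * derive1n i y = fun t => (p i).[t] * derive1n i y t
    by [].
  move/trigger_derive; apply.
  by rewrite addrC; congr (_ + _); exact: mulrC.
have S := is_derive_sum H; rewrite derive_val /dfun big_split /=.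
under [RHS]eq_bigr do rewrite /dstep hornerD mulrDl.
rewrite [RHS]big_split /=; congr (_ + _).
  by rewrite [RHS]big_ord_recr /= p0// deriv0 horner0 mul0r addr0.
by rewrite [RHS]big_ord_recl /= horner0 mul0r add0r.
Qed.

(** An identity at [x] alone cannot be differentiated, hence the formulation near [x]. The bound on
    [m + k] keeps all derivatives within the order [L] that is available. *)
Lemma derive1n_dfun L m k p y x : (m + k <= L.+1)%N ->
  (forall i, (m <= i)%N -> p i = 0) -> times_derivable L y x ->
  \forall z \near x, derive1n k (dfun m p y) z = dfun (m + k) (iter k dstep p)
    y z.
Proof.
move=> + p0 dy; elim: k => [_|k IH mk]; first by near=> z; rewrite addn0.
have {}IH := near_join (IH (ltnW _)).
have dy' := near_join dy.
near=> z.
have Iz : \forall t \near z, derive1n k (dfun m p y) t = dfun (m + k) (iter k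
  dstep p) y t.
  by near: z; apply: IH; rewrite -addnS.
rewrite derive1nS derive1E (near_eq_derive _ Iz) is_derive_dfun ?addnS//.
  by move=> i; apply: iter_dstep_eq0.
move=> i im; suff : forall i, (i < L)%N -> derivable (derive1n i y) z 1.
  by apply; lia.
by near: z.
Unshelve. all: by end_near. Qed.

Lemma derive1n_jop K U V y x : times_derivable (2 * K) y x ->
  derive1n K (fun t => V.[t] * derive1n K (fun s => U.[s] * y s) t) x =
  dfun (2 * K).+1 (jop K U V) y x.
Proof.
move=> dy.
have -> : (fun s => U.[s] * y s) = dfun 1 (dzero U) y.
  by apply/funext => t; rewrite /dfun big_ord1.
have h1 := @derive1n_dfun (2 * K) 1 K (dzero U) y x _ (@dzero_eq0 _ U) dy.
have {}h1 : \forall z \near x, V.[z] * derive1n K (dfun 1 (dzero U) y) z =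
    dfun (1 + K) (fun i => V * iter K dstep (dzero U) i) y z.
  apply: filterS (h1 _) => [z ->|]; last by lia.
  by rewrite /dfun mulr_sumr; apply: eq_bigr => i _; rewrite hornerM mulrA.
rewrite (nbhs_singleton (near_eq_derive1n K h1)).
have h2 := @derive1n_dfun (2 * K) (1 + K) K _ y x _ (@inner_eq0 _ K U V) dy.
rewrite (nbhs_singleton (h2 _)); last by lia.
by congr dfun; lia.
Qed.

Lemma expands_rcoef (den pref U V : {poly R}) K (T : (R -> R) -> R -> R) :
  (forall i, den %| pref * jop K U V i) -> jop K U V 0%N = 0 ->
  (forall y x, x != 1 -> x != -1 -> den.[x] * T y x = pref.[x] *
    derive1n K (fun t => V.[t] * derive1n K (fun s => U.[s] * y s) t) x) ->
  (forall x, x != 1 -> x != -1 -> den.[x] != 0) ->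
  expands_as T (2 * K) (rcoef pref den K U V).
Proof.
move=> dvd j0 HT den0 y x x1 xN1 dy; apply: (mulfI (den0 _ x1 xN1)).
rewrite HT// derive1n_jop// /dfun /diffop !mulr_sumr.
rewrite -(big_mkord predT (fun i => pref.[x] * ((jop K U V i).[x] * derive1n i
  y x))).
rewrite big_ltn// j0 horner0 mul0r mulr0 add0r; apply: eq_bigr => i _.
by rewrite !mulrA -!hornerM /rcoef [den * _]mulrC divpK.
Qed.

Lemma derive1n_horner k q : derive1n k (horner q) = horner q^`(k).
Proof.
elim: k => [|k IH]; first by rewrite derivn0.
by rewrite derive1nS IH -derivE derivnS.
Qed.

Lemma times_derivable_horner L q x : times_derivable L (horner q) x.
Proof.
near=> z => i _; rewrite derive1n_horner; exact: derivable_horner.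
Unshelve. all: by end_near. Qed.

Lemma diffop_horner m (p : nat -> {poly R}) q x :
  diffop m p (horner q) x = (diffopp m p q).[x].
Proof.
rewrite /diffop /diffopp horner_sum; apply: eq_bigr => i _.
by rewrite derive1n_horner hornerM.
Qed.

Lemma expands_L2 a b : expands_as (@L2 R a b) 2 (coef2 R a b).
Proof.
apply: (@expands_rcoef _ _ _ _ 1); first exact: dvdp_coef2.
- exact: (jop_0 _ (monic1 R) (size_poly1 R)).
- move=> y x x1 xN1; rewrite /L2 hornerM !horner_exp hornerXsubC hornerD
  hornerX.
  rewrite !hornerC mul1r mulrA mulfV ?mul1r.
    congr (derive1n 1 _ x); apply/funext => t.
    rewrite hornerM !horner_exp hornerXsubC hornerD hornerX !hornerC.
    by congr (_ * _); congr (derive1n 1 _ t); apply/funext => s; rewrite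
      hornerC mul1r.
  by rewrite mulf_neq0 ?expf_neq0// ?subr_eq0// addr_eq0.
- move=> x x1 xN1; rewrite hornerM !horner_exp hornerXsubC hornerD hornerX
  hornerC.
  by rewrite mulf_neq0 ?expf_neq0// ?subr_eq0// addr_eq0.
Qed.

Lemma expands_Ltilde a b : expands_as (@Ltilde R b a) (2 * b.+2) (coef4 1 a b).
Proof.
have vm : ('X + 1%:P : {poly R}) ^+ b.+1 \is monic by rewrite monic_exp
  ?monicXaddC.
apply: expands_rcoef; first exact: dvdp_coef4.
- exact: jop_0 vm (size_exp_XaddC _ _).
- move=> y x x1 xN1; rewrite /Ltilde horner_exp hornerXsubC hornerD hornerX
  hornerC.
  rewrite mulrA [X in X * _]mulrC divfK ?expf_neq0 ?subr_eq0// !addn2.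
  apply: (congr1 (fun f : R -> R => (x + 1) * derive1n b.+2 f x)); apply/funext
    => t.
  rewrite horner_exp hornerXsubC.
  apply: (congr1 (fun f : R -> R => (t - 1) ^+ (a + b).+2 * derive1n b.+2 f
    t)); apply/funext => s.
  by rewrite horner_exp hornerD hornerX hornerC.
- by move=> x x1 xN1; rewrite horner_exp hornerXsubC expf_neq0 ?subr_eq0.
Qed.

Lemma expands_L4 a b : expands_as (@L4 R a b) (2 * a.+2) (coef4 (-1) b a).
Proof.
have vm : ('X + (-1)%:P : {poly R}) ^+ a.+1 \is monic by rewrite monic_exp
  ?monicXaddC.
apply: expands_rcoef; first exact: dvdp_coef4.
- exact: jop_0 vm (size_exp_XaddC _ _).
- move=> y x x1 xN1; rewrite /L4 horner_exp hornerXsubC hornerD hornerX hornerC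
  opprK.
  rewrite mulrA [X in X * _]mulrC divfK ?expf_neq0 ?addr_eq0// !addn2 [(b +
    a)%N]addnC.
  apply: (congr1 (fun f : R -> R => (x - 1) * derive1n a.+2 f x)); apply/funext
    => t.
  rewrite horner_exp hornerXsubC opprK.
  apply: (congr1 (fun f : R -> R => (t + 1) ^+ (a + b).+2 * derive1n a.+2 f
    t)); apply/funext => s.
  by rewrite horner_exp hornerD hornerX hornerC.
- by move=> x x1 xN1; rewrite horner_exp hornerXsubC opprK expf_neq0 ?addr_eq0.
Qed.

Lemma expands_L6 a b : expands_as (@L6 R a b) (2 * (a + b).+3) (coef6 R a b).
Proof.
apply: expands_rcoef; first by move=> i; exact: dvd1p.
- apply: jop_0 (monic_XsubC_XaddC _ _ _) _.
  by rewrite size_XsubC_XaddC addSn addnS.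
- move=> y x x1 xN1; rewrite /L6 hornerC mul1r hornerD hornerXn hornerN hornerC
  addn3.
  apply: (congr1 (fun f : R -> R => (x ^+ 2 - 1) * derive1n (a + b).+3 f x));
    apply/funext => t.
  rewrite hornerM !horner_exp hornerXsubC hornerD hornerX hornerC.
  apply: (congr1 (fun f : R -> R => (t - 1) ^+ b.+1 * (t + 1) ^+ a.+1 *
    derive1n (a + b).+3 f t)); apply/funext => s.
  by rewrite hornerM !horner_exp hornerXsubC hornerD hornerX hornerC.
- by move=> x x1 xN1; rewrite hornerC oner_neq0.
Qed.

(** An evaluated identity of polynomials, free of quotients, so it also holds at 1 and -1. *)
Lemma gen_jacobi_diffop a b M N n (x : R) : 0 <= M -> 0 <= N ->
  gen_jacobi_lhs a b M N n (diffop 2 (coef2 R a b))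
    (diffop (2 * b.+2) (coef4 1 a b)) (diffop (2 * a.+2) (coef4 (-1) b a))
    (diffop (2 * (a + b).+3) (coef6 R a b)) (horner (koornp M N n a b)) x = 0.
Proof.
move=> M0 N0; have := congr1 (horner^~ x) (opL_koornp n a b M0 N0).
rewrite /gen_jacobi_lhs !diffop_horner !bconstE cconstE Lambda2E !Lambda4E
  Lambda6E.
rewrite /opL /op2 /op4 /op6 /eigenL.
move: (koornp M N n a b) (diffopp _ _ _) (diffopp _ _ _) (diffopp _ _ _)
  (diffopp _ _ _).
move=> y f2 f4 f4' f6 /=.
rewrite !hornerD !hornerZ => /eqP; rewrite -subr_eq0 => /eqP <-; ring.
Qed.

End Expansion.

Theorem theorem2p1 (R : realType) (alpha beta : nat) (M N : R)
    (hM : 0 < M) (hN : 0 < N) :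
  let y := fun n : nat => koornwinder n alpha%:R beta%:R M N in
  (forall n : nat,
     (exists x : R, y n x <> 0) /\
     (forall x : R, x != 1 -> x != -1 ->
        gen_jacobi_lhs alpha beta M N n
          (L2 alpha beta) (Ltilde beta alpha) (L4 alpha beta) (L6 alpha beta)
          (y n) x = 0)) /\
  (exists c dt d e : nat -> {poly R},
     [/\ [/\ expands_as (L2 alpha beta) 2 c,
             expands_as (Ltilde beta alpha) (2 * beta + 4) dt,
             expands_as (L4 alpha beta) (2 * alpha + 4) d
           & expands_as (L6 alpha beta) (2 * alpha + 2 * beta + 6) e],
         (* the equation on the whole line, including x = 1 and x = -1 *)
         forall (n : nat) (x : R),
           gen_jacobi_lhs alpha beta M N n
             (diffop 2 c) (diffop (2 * beta + 4) dt) (diffop (2 * alpha + 4) d)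
             (diffop (2 * alpha + 2 * beta + 6) e) (y n) x = 0,
         (* degrees; e 1 is in fact 0, so there i only bounds the degree *)
         [/\ forall i : nat, (1 <= i <= 2)%N -> size (c i) = i.+1,
             forall i : nat, (1 <= i <= 2 * beta + 4)%N -> size (dt i) = i.+1,
             forall i : nat, (1 <= i <= 2 * alpha + 4)%N -> size (d i) = i.+1,
             forall i : nat, (2 <= i <= 2 * alpha + 2 * beta + 6)%N ->
               size (e i) = i.+1
           & (size (e 1%N) <= 2)%N]
       & [/\ c 1%N = (alpha%:R - beta%:R)%:P + (alpha%:R + beta%:R + 2) *: 'X,
             c 2%N = 'X^2 - 1,
             dt (2 * beta + 4)%N = ('X^2 - 1) ^+ (beta + 2),
             d (2 * alpha + 4)%N = ('X^2 - 1) ^+ (alpha + 2)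
           & e (2 * alpha + 2 * beta + 6)%N
               = ('X^2 - 1) ^+ (alpha + beta + 3)]]).
Proof.
move=> y.
have yE n : y n = horner (koornp M N n alpha beta).
  by apply/funext => x; exact: koornwinderE.
have -> : (2 * beta + 4 = 2 * beta.+2)%N by lia.
have -> : (2 * alpha + 4 = 2 * alpha.+2)%N by lia.
have -> : (2 * alpha + 2 * beta + 6 = 2 * (alpha + beta).+3)%N by lia.
have eqn n x := gen_jacobi_diffop alpha beta n x (ltW hM) (ltW hN).
split=> [n|].
  split.
    (* At -1 the value is nonzero for every [n]. *)
    exists (-1); rewrite yE; apply/eqP; exact: koornp_hornerN1_neq0 (ltW hN).
  move=> x x1 xN1; rewrite /gen_jacobi_lhs yE.
  have td m := times_derivable_horner m (koornp M N n alpha beta) x.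
  by rewrite (@expands_L2 R alpha beta _ _ x1 xN1 (td _)) (@expands_Ltilde R
    alpha beta _ _ x1 xN1 (td _))
    (@expands_L4 R alpha beta _ _ x1 xN1 (td _)) (@expands_L6 R alpha beta _ _
      x1 xN1 (td _)); exact: eqn.
exists (coef2 R alpha beta), (coef4 1 alpha beta), (coef4 (-1) beta alpha),
  (coef6 R alpha beta).
split.
- split; [exact: expands_L2|exact: expands_Ltilde|exact: expands_L4|exact:
  expands_L6].
- by move=> n x; rewrite yE; exact: eqn.
- split; [exact: size_coef2|exact: size_coef4|exact: size_coef4|exact:
  size_coef6|].
  exact: size_coef6_le.
rewrite !addn2 addn3; split; [exact: coef2_1|exact: coef2_2| | |exact:
  coef6_top].
  by rewrite coef4_top// expr1n.
by rewrite coef4_top// sqrrN expr1n.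
Qed.
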